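(* Let $d\geq 1$ and let $\mathscr{A}\subseteq (0,1)^{d}$ be an analytic set. The following are equivalent: (i) $\mathscr{A}$ is contained in an $F_{\sigma}$, purely unrectifiable subset of $\mathbb{R}^d$; (ii) a typical $f\in\operatorname{Lip}_{1}([0,1]^{d})$ is nowhere differentiable in $\mathscr{A}$, i.e. the set of $f\in\operatorname{Lip}_1([0,1]^d)$ which are not differentiable at any point of $\mathscr{A}$ is residual in $\operatorname{Lip}_1([0,1]^d)$.
   Context: $\operatorname{Lip}_{1}([0,1]^{d})$ denotes the set of all functions $f\colon[0,1]^d\to\mathbb{R}$ with Lipschitz constant at most $1$, viewed as a complete metric space with the supremum metric. A property holds for a typical $f\in\operatorname{Lip}_1([0,1]^d)$ if the set of $f$ with this property is residual (its complement is meagre). A Lipschitz curve is a Lipschitz map $\gamma\colon I\to\mathbb{R}^d$, $I\subseteq\mathbb{R}$ a closed interval, whose derivative is bounded away from zero in norm almost everywhere. A set $P\subseteq\mathbb{R}^d$ is purely unrectifiable if for every Lipschitz curve $\gamma\colon[0,1]\to\mathbb{R}^d$ the set $\gamma^{-1}(P)$ has Lebesgue measure zero. *)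

(* Defs.v *)
From HB Require Import structures.
From mathcomp Require Import all_boot all_order all_algebra.
From mathcomp Require Import all_classical all_reals all_analysis.
Set Implicit Arguments. Unset Strict Implicit. Unset Printing Implicit Defensive.
Import Order.TTheory GRing.Theory Num.Theory.
Import numFieldNormedType.Exports.
Local Open Scope classical_set_scope.
Local Open Scope ring_scope.

Section Defs.
Variables (R : realType) (d : nat).
Local Notation V := 'rV[R]_d.

Definition enorm (x : V) : R := Num.sqrt (\sum_(i < d) x ord0 i ^+ 2).

Definition cube : set V := [set x | forall i, 0 <= x ord0 i <= 1].
Definition open_cube : set V := [set x | forall i, 0 < x ord0 i < 1].

(* Lip_1([0,1]^d): functions whose restriction to the cube is 1-Lipschitz
   (w.r.t. the Euclidean norm); only values on the cube matter. *)
Definition Lip1 : set (V -> R) :=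
  [set f | forall x y, cube x -> cube y -> `|f x - f y| <= enorm (x - y)].

(* uniform closeness on the cube; the sets {g | unif_close eps f g}
   generate the same topology as the supremum metric. *)
Definition unif_close (eps : R) (f g : V -> R) : Prop :=
  forall x, cube x -> `|f x - g x| < eps.

Definition rel_open_Lip1 (U : set (V -> R)) : Prop :=
  forall f, Lip1 f -> U f ->
    exists2 eps : R, 0 < eps & forall g, Lip1 g -> unif_close eps f g -> U g.

Definition dense_Lip1 (U : set (V -> R)) : Prop :=
  forall f, Lip1 f -> forall eps : R, 0 < eps ->
    exists g, [/\ Lip1 g, U g & unif_close eps f g].

Definition residual_Lip1 (S : set (V -> R)) : Prop :=
  exists U : nat -> set (V -> R),
    [/\ forall n, rel_open_Lip1 (U n),
        forall n, dense_Lip1 (U n) &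
        forall f, Lip1 f -> (forall n, U n f) -> S f].

Definition Fsigma (P : set V) : Prop :=
  exists F : nat -> set V, (forall n, closed (F n)) /\ P = \bigcup_n F n.

Definition baire_continuous (g : (nat -> nat) -> V) : Prop :=
  forall s (eps : R), 0 < eps -> exists n : nat,
    forall t : nat -> nat, (forall i, (i < n)%N -> t i = s i) ->
      enorm (g t - g s) < eps.

Definition analytic (A : set V) : Prop :=
  A = set0 \/ exists g, baire_continuous g /\ A = range g.

Definition lipschitz_curve (gam : R -> V) : Prop :=
  (exists L : R, forall s t, s \in `[0, 1] -> t \in `[0, 1] ->
      enorm (gam s - gam t) <= L * `|s - t|) /\
  (exists2 c : R, 0 < c &
     {ae (@lebesgue_measure R), forall t, t \in `[0, 1]%classic ->
        derivable gam t 1 /\ c <= enorm ('D_1 gam t)}).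

Definition purely_unrectifiable (P : set V) : Prop :=
  forall gam, lipschitz_curve gam ->
    (@lebesgue_measure R).-negligible ([set t | t \in `[0, 1]] `&` gam @^-1` P).

End Defs.

(* Main.v *)
Require Import Defs.
From HB Require Import structures.
From mathcomp Require Import all_boot all_order all_algebra.
From mathcomp Require Import all_classical all_reals all_analysis.
From mathcomp Require Import measurable_realfun ring lra.
Import Order.TTheory GRing.Theory Num.Theory.
Import numFieldNormedType.Exports.
Local Open Scope classical_set_scope.
Local Open Scope ring_scope.
Set Implicit Arguments. Unset Strict Implicit. Unset Printing Implicit Defensive.

                                                                               
                                                                           
                                                                            
                                                                             
                                                                               
                                                                              
                                                                            
                                                                               
                                                                                
                                                

                                                                                  
                                                                                
                                                                              
                                                                     
                                                                             
                                                                              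
                                                                            
                                                                           
                                                                             
                                                                              
                                                                         
                                                                              
                                                                                 

                       

(** Both conditions are compared with covers of the analytic set by countably many closed sets [F n]
    satisfying [wnull usphere (F n)]: along every Lipschitz curve, the times in [F n] at which the
    derivative is nonzero form a null set. By [pu_wnull] and [wnull_pu] this is pure
    unrectifiability. The set of admissible directions is kept as a parameter of [wnull] because the
    second half of the proof localises in it.

    From a cover to typical nondifferentiability: let K be one of the closed sets, cut back from the
    boundary of the cube, and e0 a coordinate vector. Every f in [Lip1] is uniformly close to a
    1-Lipschitz g with g(x + r e0) - g(x) >= 3r/4 for all x in K and one small r ([steep_approx]).
    Here g(x) is the supremum of the values collected along paths ending at x: start with a value of
    f, earn by moving along e0 close to K, pay the length travelled elsewhere. If the profit over f
    did not vanish as the neighbourhood of K shrinks, a limit path would make a profit while on K,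
    where its derivative is zero almost everywhere; this is impossible ([noninc_ae],
    [trval_approx]). So steep increments of either sign define open dense sets, and a typical f has
    difference quotients at least 1/2 and at most -1/2 at arbitrarily small scales at each point of
    the set ([wnull_residual]).

    Conversely, suppose that the set is the continuous image of Baire space and has no such cover,
    and let [U n] be open and dense. [differentiable_point] constructs a function in every [U n]
    that is differentiable at a point of the set. A stage carries a function f that is affine with
    gradient v near a point, and a piece of the set that is nowhere coverable, even when only
    directions close to v count. Take h in [U n] very close to f. Some almost straight curve in
    direction v meets the closure of the piece in positive measure ([curve_extract]). Over a density
    interval h rises almost as fast as possible along the curve, so a maximal inequality
    ([slow_point]) yields a point of the closure where it does so at all scales. A 1-Lipschitz
    function with nearly maximal slope along v and -v is nearly affine with gradient v
    ([steep_frechet]). Hence h can be made exactly affine near that point, with a new gradient close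
    to v, by a change too small to leave [U n] ([stage_step]). The limit function is differentiable
    at the limit point, its gradient being the limit of the vectors v. *)

(** * Euclidean norm and inner product on row vectors *)

Section Euclid.
Context {R : realType} {d : nat}.
Notation V := 'rV[R]_d.
Implicit Types x y z : V.

Definition dot x y : R := \sum_(i < d) x ord0 i * y ord0 i.

Lemma dotC x y : dot x y = dot y x.
Proof. by apply: eq_bigr => i _; rewrite mulrC. Qed.

Lemma dotDl x y z : dot (x + y) z = dot x z + dot y z.
Proof. by rewrite -big_split; apply: eq_bigr => i _; rewrite mxE mulrDl. Qed.

Lemma dotZl (a : R) x y : dot (a *: x) y = a * dot x y.
Proof. by rewrite mulr_sumr; apply: eq_bigr => i _; rewrite mxE mulrA. Qed.

Lemma dotNl x y : dot (- x) y = - dot x y.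
Proof. by rewrite -scaleN1r dotZl mulN1r. Qed.

Lemma dotBl x y z : dot (x - y) z = dot x z - dot y z.
Proof. by rewrite dotDl dotNl. Qed.

Lemma dotDr x y z : dot x (y + z) = dot x y + dot x z.
Proof. by rewrite dotC dotDl !(dotC _ x). Qed.

Lemma dotZr (a : R) x y : dot x (a *: y) = a * dot x y.
Proof. by rewrite dotC dotZl dotC. Qed.

Lemma dotBr x y z : dot x (y - z) = dot x y - dot x z.
Proof. by rewrite dotC dotBl !(dotC _ x). Qed.

Lemma dot_ge0 x : 0 <= dot x x.
Proof. by apply: sumr_ge0 => i _; rewrite -expr2 sqr_ge0. Qed.

Lemma enormE x : enorm x = Num.sqrt (dot x x).
Proof. by congr Num.sqrt; apply: eq_bigr => i _; rewrite expr2. Qed.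

Lemma enorm_ge0 x : 0 <= enorm x.
Proof. exact: sqrtr_ge0. Qed.

Lemma sqr_enorm x : enorm x ^+ 2 = dot x x.
Proof. by rewrite enormE sqr_sqrtr// dot_ge0. Qed.

Lemma enormN x : enorm (- x) = enorm x.
Proof. by rewrite !enormE dotNl dotC dotNl opprK. Qed.

Lemma enormC x y : enorm (x - y) = enorm (y - x).
Proof. by rewrite -enormN opprB. Qed.

Lemma enorm0 : enorm (0 : V) = 0.
Proof. by rewrite enormE /dot big1 ?sqrtr0// => i _; rewrite mxE mul0r. Qed.

Lemma enormZ (a : R) x : enorm (a *: x) = `|a| * enorm x.
Proof.
by rewrite !enormE dotZl dotC dotZl mulrA -expr2 sqrtrM ?sqr_ge0// sqrtr_sqr.
Qed.

Lemma dot_le x y : dot x y <= enorm x * enorm y.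
Proof.
have a0 := enorm_ge0 x; have b0 := enorm_ge0 y.
have [/eqP xy0|xy0] := boolP (enorm x * enorm y == 0).
  have : dot x y ^+ 2 <= 0.
    have key (u w : V) : enorm u = 0 -> dot u w ^+ 2 <= 0.
      move=> u0; have : dot u u = 0 by rewrite -sqr_enorm u0 expr0n.
      move/eqP; rewrite psumr_eq0 => [/allP uu|i _]; last by rewrite -expr2 sqr_ge0.
      rewrite /dot big1 ?expr0n// => i _.
      have := uu i; rewrite mem_index_enum => /(_ isT)/=.
      by rewrite mulf_eq0 orbb => /eqP->; rewrite mul0r.
    move/eqP: xy0; rewrite mulf_eq0 => /orP[] /eqP e0; first exact: key.
    by rewrite dotC; exact: key.
  by rewrite xy0 real_exprn_even_le0// ?num_real//= => /eqP->.
have xyp : 0 < enorm x * enorm y by rewrite lt_neqAle eq_sym xy0 mulr_ge0.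
have := dot_ge0 (enorm y *: x - enorm x *: y).
rewrite dotBl !dotBr !dotZl !dotZr -!sqr_enorm (dotC y x) => H.
have : 0 <= (enorm x * enorm y) * (enorm x * enorm y - dot x y) by nra.
by rewrite pmulr_rge0// subr_ge0.
Qed.

Lemma normr_dot_le x y : `|dot x y| <= enorm x * enorm y.
Proof. by rewrite ler_norml dot_le andbT lerNl -dotNl -(enormN x) dot_le. Qed.

Lemma ler_enormD x y : enorm (x + y) <= enorm x + enorm y.
Proof.
rewrite -ler_sqr ?nnegrE ?addr_ge0 ?enorm_ge0//.
rewrite sqr_enorm dotDl !dotDr sqrrD !sqr_enorm (dotC y x).
by have := dot_le x y; nra.
Qed.

Lemma ler_enorm_trans z x y : enorm (x - y) <= enorm (x - z) + enorm (z - y).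
Proof. by rewrite (le_trans _ (ler_enormD _ _))// addrA subrK. Qed.

Lemma ler_dist_enorm x y : `|enorm x - enorm y| <= enorm (x - y).
Proof.
rewrite ler_norml; have := ler_enormD (x - y) y; have := ler_enormD (y - x) x.
by rewrite !subrK (enormC y); lra.
Qed.

Lemma coord_le_enorm x i : `|x ord0 i| <= enorm x.
Proof.
rewrite -ler_sqr ?nnegrE ?enorm_ge0// sqr_enorm real_normK ?num_real//.
rewrite /dot (bigD1 i)//= -expr2 lerDl sumr_ge0// => j _.
by rewrite -expr2 sqr_ge0.
Qed.

Lemma enorm_le_sum x : enorm x <= \sum_(i < d) `|x ord0 i|.
Proof.
have key (s : seq 'I_d) :
  \sum_(i <- s) x ord0 i ^+ 2 <= (\sum_(i <- s) `|x ord0 i|) ^+ 2.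
  elim: s => [|i s IH]; first by rewrite !big_nil expr0n.
  rewrite !big_cons sqrrD real_normK ?num_real// -addrA lerD2l (le_trans IH)//.
  by rewrite lerDr mulrn_wge0// mulr_ge0// sumr_ge0.
rewrite -ler_sqr ?nnegrE ?enorm_ge0 ?sumr_ge0// /enorm sqr_sqrtr ?key//.
by apply: sumr_ge0 => i _; rewrite sqr_ge0.
Qed.

Lemma enorm_le_coord x (M : R) : (forall i, `|x ord0 i| <= M) ->
  enorm x <= d%:R * M.
Proof.
move=> xM; rewrite (le_trans (enorm_le_sum x))//.
apply: (@le_trans _ _ (\sum_(i < d) M)); first exact: ler_sum.
by rewrite big_const_ord iter_addr_0 mulr_natl.
Qed.

Lemma norm_le_enorm x : `|x| <= enorm x.
Proof.
rewrite [leLHS]/Num.Def.normr/= mx_normrE bigmax_le ?enorm_ge0// => -[i j] _ /=.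
by rewrite (ord1 i) coord_le_enorm.
Qed.

Lemma coord_le_norm x i : `|x ord0 i| <= `|x|.
Proof.
rewrite [leRHS]/Num.Def.normr/= mx_normrE.
by apply: le_trans (le_bigmax _ _ (ord0, i)).
Qed.

Lemma enorm_le_norm x : enorm x <= d%:R * `|x|.
Proof. by apply: enorm_le_coord => i; exact: coord_le_norm. Qed.

Lemma dot_unit x : enorm x = 1 -> dot x x = 1.
Proof. by rewrite -sqr_enorm => ->; rewrite expr1n. Qed.

End Euclid.

                                            

(** * Almost everywhere differentiability of Lipschitz functions of one variable *)

Section Rademacher.
Context {R : realType}.
Notation mu := (@lebesgue_measure R).

Definition clamp (T t : R) := Num.max 0 (Num.min t T).

Section Clamp.
Variable T : R.
Hypothesis T0 : 0 <= T.

Lemma clamp_itv t : 0 <= clamp T t <= T.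
Proof.
by have := T0; rewrite /clamp /Num.max /Num.min; do 2 (case: ifPn; rewrite -?leNgt); lra.
Qed.

Lemma clamp_id t : 0 <= t <= T -> clamp T t = t.
Proof.
by have := T0; rewrite /clamp /Num.max /Num.min; do 2 (case: ifPn; rewrite -?leNgt); lra.
Qed.

Lemma clamp_le0 t : t <= 0 -> clamp T t = 0.
Proof.
by have := T0; rewrite /clamp /Num.max /Num.min; do 2 (case: ifPn; rewrite -?leNgt); lra.
Qed.

Lemma clamp_geT t : T <= t -> clamp T t = T.
Proof.
by have := T0; rewrite /clamp /Num.max /Num.min; do 2 (case: ifPn; rewrite -?leNgt); lra.
Qed.

Lemma clamp_mono s t : s <= t -> 0 <= clamp T t - clamp T s <= t - s.
Proof.
by have := T0; rewrite /clamp /Num.max /Num.min; do 4 (case: ifPn; rewrite -?leNgt); lra.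
Qed.

Lemma clamp_lip s t : `|clamp T s - clamp T t| <= `|s - t|.
Proof.
have [/[dup] st /clamp_mono|/ltW /[dup] st /clamp_mono] := leP s t.
  by rewrite (distrC (clamp T s)) (distrC s) => h; rewrite !ger0_norm; lra.
by move=> h; rewrite !ger0_norm; lra.
Qed.

End Clamp.

Lemma inv_truncn_lt (r : R) : 0 < r -> (Num.truncn r^-1).+1%:R^-1 < r.
Proof.
move=> r0; rewrite -[ltRHS]invrK ltf_pV2 ?posrE ?invr_gt0//.
exact: truncnS_gt.
Qed.

Lemma negligible01 : mu.-negligible [set (0 : R); 1].
Proof.
apply: negligibleU; apply/negligibleP.
- exact: measurable_set1.
- exact: lebesgue_measure_set1.
- exact: measurable_set1.
- exact: lebesgue_measure_set1.
Qed.

Lemma lip_continuous (L : R) (f : R -> R) :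
  (forall s t, `|f s - f t| <= L * `|s - t|) -> continuous f.
Proof.
move=> Lf x; apply/cvgrPdist_le => e e0.
have L1 : 0 < `|L| + 1 by rewrite ltr_wpDl.
near=> y; apply: (le_trans (Lf x y)).
apply: (@le_trans _ _ ((`|L| + 1) * `|x - y|)).
  by rewrite ler_wpM2r// (le_trans (ler_norm L))// lerDl.
rewrite mulrC -ler_pdivlMr//; near: y.
by apply: cvgr_dist_le => //; exact: divr_gt0.
Unshelve. all: by end_near. Qed.

Lemma lebesgue_stieltjes_measure_oc (F : cumulative R R) (a b : R) : a <= b ->
  lebesgue_stieltjes_measure F `]a, b]%classic = (F b - F a)%:E.
Proof.
move=> ab; rewrite /lebesgue_stieltjes_measure /measure_extension.
rewrite measurable_mu_extE/=; last exact: is_ocitv.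
by rewrite wlength_itv_bnd.
Qed.

Lemma stieltjes_dominated (F G : cumulative R R) (C : R) : 0 < C ->
  (forall t, F t + G t = C * t) ->
  lebesgue_stieltjes_measure F `<< mu.
Proof.
move=> C0 FG.
have C' : 0 <= C^-1 by rewrite invr_ge0 ltW.
pose nu := mscale (NngNum C') (measure_add (lebesgue_stieltjes_measure F)
   (lebesgue_stieltjes_measure G)).
have E A : measurable A -> mu A = nu A.
  apply: lebesgue_measure_unique => X [[a b] _ /= <-].
  rewrite /nu /mscale/= /msum/= !big_ord_recl/= big_ord0 adde0.
  have [ab|ba] := leP a b; last first.
    by rewrite set_itv_ge ?bnd_simp -?leNgt ?ltW// !measure0 adde0 mule0.
  rewrite !lebesgue_stieltjes_measure_oc// /lebesgue_measure.
  rewrite lebesgue_stieltjes_measure_oc//= -EFinD -EFinM.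
  congr (_%:E); apply: (mulfI (lt0r_neq0 C0)); rewrite mulrA divff ?lt0r_neq0//.
  by rewrite mul1r mulrBr -!FG; ring.
apply/null_content_dominatesP => A mA A0.
have := E _ mA; rewrite A0 /nu /mscale/= /msum/= !big_ord_recl/= big_ord0 adde0 => /esym/eqP.
rewrite mule_eq0 eqe/= invr_eq0 (gt_eqF C0)/= padde_eq0// => /andP[/eqP-> _].
by [].
Qed.

Lemma derivable_affine_comb (f : R -> R) (a b c t : R) : derivable f t 1 ->
  derivable (a *: f + (fun x => b - c * x)) t 1.
Proof.
move=> df; apply: derivableD; first exact: derivableZ.
apply: derivableB; first exact: derivable_cst.
by apply: derivableM; [exact: derivable_cst|exact: derivable_id].
Qed.

(** After adding a linear term [f] becomes an increasing Lipschitz function, whose Stieltjes measure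
    is absolutely continuous. Its Radon-Nikodym density is integrable, and Lebesgue differentiation
    of the indefinite integral gives the derivative. *)
Lemma lipschitz_ae_derivable (L : R) (f : R -> R) :
  (forall s t, `|f s - f t| <= L * `|s - t|) ->
  mu.-negligible [set t | 0 <= t <= 1 /\ ~ derivable f t 1].
Proof.
move=> Lf.
have L0 : 0 <= L by have := Lf 1 0; rewrite subr0 normr1 mulr1; exact: le_trans.
pose p t := f t + (L + 1) * t.
have p_le s t : s <= t -> t - s <= p t - p s <= (2 * L + 1) * (t - s).
  by move=> st; have := Lf t s; rewrite /p (ger0_norm (_ : 0 <= t - s)) ?subr_ge0//
    ler_norml; lra.
pose D := p 1 - p 0.
have D1 : 1 <= D by have := p_le _ _ ler01; rewrite /D; lra.
have D0 : 0 < D by lra.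
(* Clamping to [0,1] and normalising give a continuous cumulative function that is 0 to the left of
   0 and 1 to the right of 1. *)
pose F t := (p (clamp 1 t) - p 0) / D.
pose C := (2 * L + 1) / D.
have C0 : 0 < C by rewrite divr_gt0//; lra.
have F_le s t : s <= t -> 0 <= F t - F s <= C * (t - s).
  move=> st; rewrite /F /C -mulrBl opprB addrA subrK.
  have /andP[c1 c2] := clamp_mono ler01 st.
  have /andP[p1 p2] := p_le (clamp 1 s) (clamp 1 t) ltac:(lra).
  rewrite divr_ge0/=; [|lra|lra].
  by rewrite mulrAC ler_pM2r ?invr_gt0//; nra.
have F_cont : continuous F.
  apply: (@lip_continuous C) => s t.
  have [/F_le st|/ltW/F_le st] := leP s t.
    by rewrite ler0_norm ?(ler0_norm (_ : s - t <= 0)); nra.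
  by rewrite ger0_norm ?(ger0_norm (_ : 0 <= s - t)); nra.
have G_cont : continuous (fun t => C * t - F t).
  by move=> t; apply: cvgB; [apply: cvgM; [exact: cvg_cst|exact: cvg_id]|exact: F_cont].
have F_nd : nondecreasing F by move=> s t /F_le; lra.
have G_nd : nondecreasing (fun t => C * t - F t) by move=> s t /F_le; lra.
have FNy : F @ -oo --> (0 : R).
  apply: cvg_near_cst; exists 0; split => // t t0.
  by rewrite /F (clamp_le0 ler01) ?ltW// subrr mul0r.
have Fy : F @ +oo --> (1 : R).
  apply: cvg_near_cst; exists 1; split => // t t0.
  by rewrite /F (clamp_geT ler01) ?ltW// divff// gt_eqF.
pose Fc : cumulativeBounded (0 : R) (1 : R) := HB.pack F
  (isCumulative.Build R _ R F F_nd (right_continuousW F_cont))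
  (isCumulativeBounded.Build R 0 1 F FNy Fy).
pose Gc : cumulative R R := HB.pack (fun t => C * t - F t)
  (isCumulative.Build R _ R (fun t => C * t - F t) G_nd (right_continuousW G_cont)).
have dom : lebesgue_stieltjes_measure Fc `<< mu.
  by apply: (@stieltjes_dominated Fc Gc C C0) => t /=; lra.
pose nu := charge_of_finite_measure (lebesgue_stieltjes_measure Fc).
have domn : nu `<< mu by [].
pose g := fun t => fine (Radon_Nikodym nu mu t).
have gE : EFin \o g = Radon_Nikodym nu mu.
  by apply/funext => t /=; rewrite fineK// Radon_Nikodym_fin_num.
have gint : mu.-integrable setT (EFin \o g) by rewrite gE; exact: Radon_Nikodym_integrable.
have gintS A : measurable A -> mu.-integrable A (EFin \o g).
  by move=> mA; exact: integrableS gint.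
have gloc : locally_integrable [set: R] g.
  by apply: open_integrable_locally => //; exact: openT.
(* Integration starts at -1, where [F] already vanishes, so that every t in (0,1) is interior to the
   range of integration. *)
have := @FTC1 R g (BRight (-1)) (fun y => gintS _ (measurable_itv _)) gloc.
move=> [N [mN N0 sN]].
apply: negligibleS (negligibleU (ex_intro _ N (And3 mN N0 (fun x p => p))) negligible01).
move=> t [/andP[t0 t1] ndt].
have [->|tn0] := eqVneq t 0; first by right; left.
have [->|tn1] := eqVneq t 1; first by right; right.
left; apply: sN => /= H; apply: ndt.
have tm1 : (BRight (-1) < BRight t)%O by rewrite bnd_simp; lra.
have [dF _] := H tm1.
have E : \near t, (D *: (fun x =>
      (\int[mu]_(u in [set` Interval (BRight (-1)) (BRight x)]) g u)%R) +
    (fun x => p 0 - (L + 1) * x)) t = f t.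
  near=> s.
  have s1 : 0 < s < 1.
    apply/andP; split; near: s; [apply: lt_nbhsr|apply: lt_nbhsl]; rewrite lt_neqAle ?tn1//.
    by rewrite eq_sym tn0.
  have -> : (D *: (fun x => (\int[mu]_(u in [set` Interval (BRight (-1)) (BRight x)]) g u)%R) +
      (fun x => p 0 - (L + 1) * x)) s = D * (F s - F (-1)) + (p 0 - (L + 1) * s).
    rewrite fctE /= /GRing.scale/=; congr (_ * _ + _).
    rewrite /Rintegral -[RHS]/(fine (F s - F (-1))%:E); congr fine.
    transitivity (nu `]-1, s]%classic).
      have := @Radon_Nikodym_integral _ _ _ nu mu `]-1, s]%classic domn (measurable_itv _).
      by rewrite -gE => /esym; exact.
    by rewrite [nu _]lebesgue_stieltjes_measure_oc//; lra.
  rewrite /F (clamp_id ler01 (t := s)); last lra.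
  rewrite (clamp_le0 ler01); last lra.
  by rewrite subrr mul0r subr0 /p; field; rewrite gt_eqF.
apply: near_eq_derivable E _.
exact: derivable_affine_comb.
Unshelve. all: by end_near. Qed.

End Rademacher.

                                       

Lemma ex2_exand (T : Type) (P Q : T -> Prop) :
  (exists2 x, P x & Q x) -> exists x, P x /\ Q x.
Proof. by move=> [x]; exists x. Qed.

(** * Lipschitz curves and sets that are null in given directions *)

Section Curves.
Context {R : realType} {d : nat}.
Notation V := 'rV[R]_d.
Notation mu := (@lebesgue_measure R).

(** McShane extension: the supremum of the downward cones of slope [L] with apex on the graph. *)
Lemma lipschitz_extension (D : set R) (L : R) (f : R -> R) : 0 <= L ->
  (forall s t, D s -> D t -> `|f s - f t| <= L * `|s - t|) ->
  exists2 g : R -> R, (forall s t, `|g s - g t| <= L * `|s - t|) &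
    forall t, D t -> g t = f t.
Proof.
move=> L0 Lf; have [/eqP D0|/set0P[a Da]] := boolP (D == set0).
  exists (fun=> 0) => [s t|t]; first by rewrite subrr normr0 mulr_ge0.
  by rewrite D0.
pose S t := [set f s - L * `|t - s| | s in D].
have Sub t u : D u -> ubound (S t) (f u + L * `|t - u|).
  move=> Du _ [s Ds <-]; have := Lf s u Ds Du; rewrite ler_norml.
  have := ler_normD (s - t) (t - u); rewrite addrA subrK (distrC s t).
  by nra.
have Ssup t : has_sup (S t).
  split; first by exists (f a - L * `|t - a|); exists a.
  by exists (f a + L * `|t - a|); exact: Sub.
have half s t : sup (S s) <= sup (S t) + L * `|s - t|.
  apply: ge_sup; first exact: (Ssup s).1.
  move=> _ [u Du <-]; rewrite -lerBlDr.
  apply: (@le_trans _ _ (f u - L * `|t - u|)); last first.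
    by apply: ub_le_sup; [exact: (Ssup t).2|exists u].
  by have := ler_normD (t - s) (s - u); rewrite addrA subrK (distrC t s); nra.
exists (fun t => sup (S t)) => [s t|t Dt].
  by have := half s t; have := half t s; rewrite ler_norml (distrC t s); lra.
apply/eqP; rewrite eq_le; apply/andP; split.
  by apply: ge_sup; [exact: (Ssup t).1|have := Sub t t Dt; rewrite subrr normr0 mulr0 addr0].
apply: ub_le_sup; first exact: (Ssup t).2.
by exists t => //; rewrite subrr normr0 mulr0 subr0.
Qed.

Lemma negligible_countable (T : countType) (F : T -> set R) :
  (forall k, mu.-negligible (F k)) -> mu.-negligible [set t | exists k, F k t].
Proof.
move=> nF; pose G n := if unpickle n is Some k then F k else set0.
have nG : mu.-negligible (\bigcup_n G n).
  apply: negligible_bigcup => n; rewrite /G.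
  by case: unpickle => // ; exact: negligible_set0.
apply: negligibleS nG => t [k Fkt]; exists (pickle k) => //.
by rewrite /G pickleK.
Qed.

Lemma derive1_approx (f : R -> R) t : derivable f t 1 -> forall e, 0 < e ->
  exists2 r, 0 < r & forall s, `|s - t| < r ->
    `|f s - f t - (s - t) * 'D_1 f t| <= e * `|s - t|.
Proof.
move=> /cvgrPdist_le df e e0; have [r r0 fr] := df e e0.
exists r => // s st.
have [->|nst] := eqVneq s t; first by rewrite !subrr mul0r subrr normr0 mulr0.
have st0 : s - t != 0 by rewrite subr_eq0.
have := fr (s - t); rewrite /= sub0r normrN => /(_ st st0).
rewrite scaler1 subrK /GRing.scale/= => fst.
have -> : f s - f t - (s - t) * 'D_1 f t =
  - ((s - t) * ('D_1 f t - (s - t)^-1 * (f s - f t))) by field.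
by rewrite normrN normrM mulrC ler_wpM2r.
Qed.

Lemma approx_derive1 (f : R -> R) t w : (forall e, 0 < e ->
  exists2 r, 0 < r & forall s, `|s - t| < r ->
    `|f s - f t - (s - t) * w| <= e * `|s - t|) ->
  derivable f t 1 /\ 'D_1 f t = w.
Proof.
move=> fw.
suff H : (fun h => h^-1 *: ((f \o shift t) (h *: 1) - f t)) @ 0^' --> w.
  by split; [apply/cvg_ex; exists w|exact/cvg_lim].
apply/cvgrPdist_le => e e0; have [r r0 fr] := fw e e0.
exists r => // h /=; rewrite sub0r normrN => hr h0.
have := fr (h + t); rewrite addrK => /(_ hr).
rewrite scaler1 /GRing.scale/= => fh.
have -> : w - h^-1 * (f (h + t) - f t) = - h^-1 * (f (h + t) - f t - h * w) by field.
by rewrite normrM normrN normfV mulrC ler_pdivrMr ?normr_gt0.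
Qed.

(** A first-order expansion with explicit radii, coordinate by coordinate; the conversions to and
    from [derivable] with value ['D_1] follow. *)
Definition hasder (g : R -> V) (t : R) (w : V) := forall e, 0 < e ->
  exists2 r, 0 < r & forall s, `|s - t| < r -> forall i,
    `|g s ord0 i - g t ord0 i - (s - t) * w ord0 i| <= e * `|s - t|.

Definition lipc (g : R -> V) := exists L, forall s t i,
  `|g s ord0 i - g t ord0 i| <= L * `|s - t|.

Lemma ord_min_radius (P : 'I_d -> R -> Prop) :
  (forall i r r', 0 < r' -> r' <= r -> P i r -> P i r') ->
  (forall i, exists2 r, 0 < r & P i r) -> exists2 r, 0 < r & forall i, P i r.
Proof.
move=> mono ex; have [r rP] := choice (fun i => ex2_exand (ex i)).
exists (\big[Num.min/1]_i r i).
  by apply: lt_bigmin => // i _; have [] := rP i.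
move=> i; have [r0 Pr] := rP i; apply: mono Pr; last exact: bigmin_le.
by apply: lt_bigmin => // j _; have [] := rP j.
Qed.

Lemma coord_hasder (g : R -> V) t (w : V) :
  (forall i, forall e, 0 < e -> exists2 r, 0 < r & forall s, `|s - t| < r ->
    `|g s ord0 i - g t ord0 i - (s - t) * w ord0 i| <= e * `|s - t|) ->
  hasder g t w.
Proof.
move=> H e e0.
have [r r0 rP] := @ord_min_radius (fun i r => forall s, `|s - t| < r ->
    `|g s ord0 i - g t ord0 i - (s - t) * w ord0 i| <= e * `|s - t|)
    (fun i r r' _ r'r P s sr' => P s (lt_le_trans sr' r'r)) (fun i => H i e e0).
by exists r => // s sr i; exact: rP.
Qed.

Lemma derivable_hasder (g : R -> V) t : derivable g t 1 -> hasder g t ('D_1 g t).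
Proof.
move=> dg; apply: coord_hasder => i e e0.
have /derivable_mxP/(_ ord0 i) dgi := dg.
by have := derive1_approx dgi e0; rewrite (derive_mx dg) mxE.
Qed.

Lemma hasder_derivable (g : R -> V) t w :
  hasder g t w -> derivable g t 1 /\ 'D_1 g t = w.
Proof.
move=> H.
have Hi i : derivable (fun s => g s ord0 i) t 1 /\ 'D_1 (fun s => g s ord0 i) t = w ord0 i.
  by apply: approx_derive1 => e e0; have [r r0 rP] := H e e0; exists r => // s sr; exact: rP.
have dg : derivable g t 1 by apply/derivable_mxP => i j; rewrite (ord1 i); exact: (Hi j).1.
split=> //; apply/rowP => i; rewrite (derive_mx dg) mxE; exact: (Hi i).2.
Qed.

Lemma lipc_hasder (g : R -> V) : lipc g ->
  mu.-negligible [set t | 0 <= t <= 1 /\ ~ exists w, hasder g t w].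
Proof.
move=> [L Lg].
apply: negligibleS (negligible_countable (F := fun i : 'I_d =>
  [set t | 0 <= t <= 1 /\ ~ derivable (fun s => g s ord0 i) t 1]) _); last first.
  by move=> i; apply: (@lipschitz_ae_derivable _ L) => s t; exact: Lg.
move=> t [t01 ngt]; apply: contrapT => H; apply: ngt.
have dg : derivable g t 1.
  apply/derivable_mxP => i j; rewrite (ord1 i); apply: contrapT => nd.
  by apply: H; exists j.
by exists ('D_1 g t); exact: derivable_hasder.
Qed.

                                                                              
                                                                                     
(** Only the oriented direction of the derivative is tested, through the positive factor [m]. For
    [W] the unit sphere the condition says that the derivative is zero at almost every time spent in
    [F]. *)
Definition wnull (W F : set V) := forall g, lipc g ->
  mu.-negligible [set t | [/\ 0 <= t <= 1, F (g t) &
    exists m w, [/\ 0 < m, W w & hasder g t (m *: w)]]].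

Lemma wnull0 F : wnull set0 F.
Proof.
move=> g _; apply: negligibleS (@negligible_set0 _ _ _ mu).
by move=> t [_ _ [m [w []]]].
Qed.

Lemma wnullU W1 W2 F : wnull W1 F -> wnull W2 F -> wnull (W1 `|` W2) F.
Proof.
move=> n1 n2 g lg; apply: negligibleS (negligibleU (n1 g lg) (n2 g lg)).
by move=> t [t01 Fg [m [w [m0 [W1w|W2w] H]]]]; [left|right]; split=> //; exists m, w.
Qed.

Lemma wnullS W1 W2 F1 F2 : W1 `<=` W2 -> F1 `<=` F2 -> wnull W2 F2 -> wnull W1 F1.
Proof.
move=> W12 F12 n2 g lg; apply: negligibleS (n2 g lg).
by move=> t [t01 /F12 Fg [m [w [m0 /W12 W1w H]]]]; split => //; exists m, w.
Qed.

(** A property of sets of directions that passes to subsets and finite unions needs checking on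
    small boxes only, since a bounded set is covered by finitely many of them. *)
Lemma box_ind (P : set V -> Prop) W (k : R) : 0 < k ->
  (forall (w : V) i, W w -> `|w ord0 i| <= 1) -> P set0 ->
  (forall A B, P A -> P B -> P (A `|` B)) -> (forall A B, A `<=` B -> P B -> P A) ->
  (forall v, W v -> P (W `&` [set w | forall i, `|w ord0 i - v ord0 i| <= k])) ->
  P W.
Proof.
move=> k0 W1 P0 PU PS PW.
have cB : compact [set v : V | forall i, v ord0 i \in `[-1, 1]].
  exact: (@rV_compact R d (fun=> `[-1, 1]%classic)) (fun=> @segment_compact _ _ _).
have k2 : 0 < k / 2 by rewrite divr_gt0.
move: cB; rewrite compact_cover => /(_ V setT (fun v => ball v (k / 2))).
case=> [v _|v _|D _ sD]; first exact: ball_open.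
  by exists v => //; exact: ballxx.
apply: (@PS _ (\big[setU/set0]_(v <- finmap.enum_fset D) (W `&` ball v (k / 2)))).
  move=> w Ww; have /sD : forall i, w ord0 i \in `[-1, 1].
    by move=> i; rewrite in_itv/= -ler_norml; exact: W1.
  move=> [v /= vD vw]; rewrite -bigcup_seq; exists v => //.
elim: (finmap.enum_fset D) => [|v s IH]; first by rewrite big_nil.
rewrite big_cons; apply: PU => //.
have [/eqP->//|/set0P[w0 [Ww0 vw0]]] := boolP (W `&` ball v (k / 2) == set0).
apply: PS (PW w0 Ww0) => w [Ww vw]; split=> // i.
move: vw0 vw; rewrite -!ball_normE/= => vw0 vw.
have := coord_le_norm (v - w0) i; have := coord_le_norm (v - w) i.
rewrite !mxE => h1 h2.
rewrite (_ : _ - _ = (v ord0 i - w0 ord0 i) - (v ord0 i - w ord0 i)); last ring.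
by apply: (le_trans (ler_normB _ _)); lra.
Qed.

(** The bad times of a curve are split into countably many pieces on which a rational speed [la] and
    a scale 1/(n+1) are fixed, each piece lying in an interval of length 1/(n+1). On a nonnegligible
    piece, subtracting the uniform motion [la *: v] leaves a map with Lipschitz constant
    [2 * k * la] in each coordinate. Extending that map to the line gives an almost straight curve
    through the same points. *)
Lemma curve_extract W F (v : V) (k : R) : 0 < k -> (forall i, `|v ord0 i| <= 1) ->
  (forall (w : V) i, W w -> `|w ord0 i - v ord0 i| <= k) -> ~ wnull W F ->
  exists la : R, exists2 g : R -> V,
    0 < la /\ (forall s t i, `|g s ord0 i - g t ord0 i - (s - t) * (la * v ord0 i)|
                 <= 2 * k * la * `|s - t|) &
    ~ mu.-negligible [set t | 0 <= t <= 1 /\ F (g t)].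
Proof.
move=> k0 v1 Wv; apply: contra_notP => H g [L Lg].
pose D (x : rat * nat * nat) := let: (q, n, j) := x in
  [set t | [/\ 0 <= t <= 1, F (g t), 0 < ratr q :> R,
     forall s, `|s - t| < n.+1%:R^-1 -> forall i,
       `|g s ord0 i - g t ord0 i - (s - t) * (ratr q * v ord0 i)|
          <= 2 * k * ratr q * `|s - t| &
     Num.truncn (t * n.+1%:R) = j]].
apply: negligibleS (negligible_countable (F := D) _).
  move=> t [t01 Fg [m [w [m0 Ww gtw]]]].
  (* The rational speed lies in (m - x, m): so close to [m] that replacing [m *: w] by [la *: v]
     costs at most 3/2 * k * la per coordinate, leaving k * la / 2 for the error of the
     derivative. *)
  pose x := Num.min (m / 8) (k * m / 8).
  have x0 : 0 < x by rewrite lt_min !divr_gt0// mulr_gt0.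
  have x1 : x <= m / 8 by rewrite ge_min lexx.
  have x2 : x <= k * m / 8 by rewrite ge_min lexx orbT.
  have [q] := @rat_in_itvoo R (m - x) m ltac:(lra).
  rewrite in_itv/=; set la : R := ratr q => /andP[q1 q2].
  have la0 : 0 < la by lra.
  have [r r0 gr] := gtw (k * la / 2) ltac:(by rewrite divr_gt0// mulr_gt0).
  exists (q, Num.truncn r^-1, Num.truncn (t * (Num.truncn r^-1).+1%:R)); split=> //.
  move=> s sr i; rewrite -/la; have {}sr : `|s - t| < r.
    exact: lt_trans sr (inv_truncn_lt r0).
  have := gr s sr i; rewrite mxE; have := Wv w i Ww; have := v1 i => v1i wvi.
  have e1 : `|m * w ord0 i - la * v ord0 i| <= 3 / 2 * k * la.
    rewrite (_ : _ - _ = m * (w ord0 i - v ord0 i) + (m - la) * v ord0 i); last ring.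
    apply: (le_trans (ler_normD _ _)); rewrite !normrM (gtr0_norm m0).
    rewrite (gtr0_norm (_ : 0 < m - la)); last lra.
    have n1 := normr_ge0 (v ord0 i).
    have := ler_wpM2l (ltW m0) wvi.
    have : (m - la) * `|v ord0 i| <= x by nra.
    by nra.
  move=> e2.
  rewrite (_ : _ - _ = (g s ord0 i - g t ord0 i - (s - t) * (m * w ord0 i)) +
    (s - t) * (m * w ord0 i - la * v ord0 i)); last ring.
  apply: (le_trans (ler_normD _ _)); rewrite normrM.
  by have := ler_wpM2l (normr_ge0 (s - t)) e1; nra.
case=> [[q n] j]; have [q0|q0] := ltP 0 (ratr q : R); last first.
  by apply: negligibleS (@negligible_set0 _ _ _ mu) => t [_ _]; rewrite ltNge q0.
set la : R := ratr q in q0 *.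
apply: contrapT => nD; apply: H.
(* Equal values [j] force |s - t| < 1/(n+1), so the local estimate of the piece applies to any two
   of its points. *)
have Dlip i s t : D (q, n, j) s -> D (q, n, j) t ->
  `|(g s ord0 i - s * (la * v ord0 i)) - (g t ord0 i - t * (la * v ord0 i))|
    <= 2 * k * la * `|s - t|.
  move=> [/andP[s0 _] _ _ _ sj] [/andP[t0 _] _ _ Ht tj].
  rewrite (_ : _ - _ = g s ord0 i - g t ord0 i - (s - t) * (la * v ord0 i)); last ring.
  apply: Ht.
  have n0 : 0 < n.+1%:R :> R by [].
  have /andP[a1 a2] := truncn_itv (mulr_ge0 s0 (ltW n0)).
  have /andP[b1 b2] := truncn_itv (mulr_ge0 t0 (ltW n0)).
  rewrite sj in a1 a2; rewrite tj in b1 b2.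
  rewrite -(ltr_pM2r n0) mulVf ?gt_eqF// -[X in _ * X](gtr0_norm n0) -normrM mulrBl.
  by move: a2 b2; rewrite -natr1 ltr_norml; lra.
have k2 : 0 <= 2 * k * la by apply: mulr_ge0; [apply: mulr_ge0; lra|exact: ltW].
have [h hP] := choice (fun i => ex2_exand (lipschitz_extension k2 (Dlip i))).
exists la, (fun t => \row_i (h i t + t * (la * v ord0 i))).
  split=> // s t i; rewrite !mxE.
  rewrite (_ : _ - _ = h i s - h i t); last ring.
  exact: (hP i).1.
apply: contra_not nD; apply: negligibleS => t Dt; have [t01 Fg _ _ _] := Dt; split=> //.
suff -> : \row_i (h i t + t * (la * v ord0 i)) = g t by [].
by apply/rowP => i; rewrite mxE (hP i).2// subrK.
Qed.

End Curves.

(** * Pure unrectifiability as nullness in all directions *)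

Section PU.
Context {R : realType} {d : nat}.
Notation V := 'rV[R]_d.

Definition usphere : set V := [set w | enorm w = 1].

Lemma usphere_coord w i : usphere w -> `|w ord0 i| <= 1.
Proof. by move=> <-; exact: coord_le_enorm. Qed.

Lemma hasder_close (g : R -> V) t w (u : V) (K : R) : hasder g t w ->
  (forall s i, `|g s ord0 i - g t ord0 i - (s - t) * u ord0 i| <= K * `|s - t|) ->
  forall i, `|w ord0 i - u ord0 i| <= K.
Proof.
move=> gw gu i; apply/ler_addgt0Pr => e e0; have [r r0 gr] := gw e e0.
have sr : `|(t + r / 2) - t| = r / 2 by rewrite addrC addKr gtr0_norm// divr_gt0.
have r2 : 0 < r / 2 by rewrite divr_gt0.
have := gr (t + r / 2); rewrite sr => /(_ ltac:(lra) i) h1.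
have := gu (t + r / 2) i; rewrite sr => h2.
rewrite -(ler_pM2l r2) -{1}(gtr0_norm r2) -normrM.
have e1 : t + r / 2 - t = r / 2 by ring.
rewrite e1 in h1 h2.
rewrite (_ : r / 2 * _ = (g (t + r / 2) ord0 i - g t ord0 i - r / 2 * u ord0 i) -
  (g (t + r / 2) ord0 i - g t ord0 i - r / 2 * w ord0 i)); last ring.
by apply: (le_trans (ler_normB _ _)); lra.
Qed.

Lemma lipc_enorm (g : R -> V) L : (forall s t i,
  `|g s ord0 i - g t ord0 i| <= L * `|s - t|) ->
  forall s t, enorm (g s - g t) <= d%:R * L * `|s - t|.
Proof. by move=> Lg s t; rewrite -mulrA; apply: enorm_le_coord => i; rewrite !mxE. Qed.

(** A curve that violates nullness may have vanishing derivative on a large set, so it is no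
    admissible test curve. The curve extracted from it in a small box of directions is
    admissible. *)
Lemma pu_wnull (F : set V) : (1 <= d)%N -> purely_unrectifiable F -> wnull usphere F.
Proof.
move=> d1 puF.
have dp : 1 <= d%:R :> R by rewrite (_ : 1 = 1%:R)// ler_nat.
have dp0 : 0 < d%:R :> R by lra.
(* With this box size the derivative of the extracted curve differs from [la *: v] by at most d * 2
   * k * la = la / 2, so its speed is at least la / 2. *)
pose k : R := (4 * d%:R)^-1.
have k0 : 0 < k by rewrite invr_gt0; lra.
have dk : d%:R * k = 4^-1 by rewrite /k; field; rewrite gt_eqF.
apply: (@box_ind _ _ (fun W => wnull W F) _ k k0).
- by move=> w i; exact: usphere_coord.
- exact: wnull0.
- by move=> A B; exact: wnullU.
- by move=> A B AB; exact: (wnullS AB (@subset_refl _ F)).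
move=> v v1; apply: contrapT.
move=> /(@curve_extract _ _ _ _ v k k0 (fun i => usphere_coord i v1)).
case=> [w i [_]|la [g [la0 lag]]]; first exact.
apply; have gL s t i : `|g s ord0 i - g t ord0 i| <= (la + 2 * k * la) * `|s - t|.
  rewrite (_ : _ - _ = (g s ord0 i - g t ord0 i - (s - t) * (la * v ord0 i)) +
     (s - t) * (la * v ord0 i)); last ring.
  apply: (le_trans (ler_normD _ _)); rewrite [in X in _ + X]normrM normrM (gtr0_norm la0).
  have := lag s t i; have := ler_wpM2l (ltW la0) (usphere_coord i v1).
  by have := normr_ge0 (s - t); nra.
have gc : lipschitz_curve g.
  split; first by exists (d%:R * (la + 2 * k * la)) => s t _ _; exact: lipc_enorm.
  exists (la / 2); first by rewrite divr_gt0.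
  have := @lipc_hasder _ _ g (ex_intro _ _ gL).
  apply: negligibleS => t /= /not_implyP[t01 H]; move: t01; rewrite inE/= in_itv/= => t01.
  split=> // -[w gw]; apply: H; have [dg gE] := hasder_derivable gw.
  split=> //; rewrite gE.
  have wv : enorm (w - la *: v) <= d%:R * (2 * k * la).
    apply: enorm_le_coord => i.
    have := @hasder_close g t w (la *: v) (2 * k * la) gw.
    by move=> /(_ _ i); rewrite !mxE; apply => s j; rewrite mxE; exact: lag.
  have := ler_enormD (la *: v - w) w; rewrite subrK enormZ v1 gtr0_norm// mulr1 enormC.
  have : d%:R * (2 * k * la) = la / 2.
    have -> : d%:R * (2 * k * la) = 2 * la * (d%:R * k) by ring.
    by rewrite dk; lra.
  by move=> E; rewrite E in wv; lra.
apply: negligibleS (puF g gc) => t [t01 Fg]; split=> //=.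
Qed.

(** A test curve is Lipschitz on [0,1] only; composing it with [clamp 1] makes it Lipschitz on the
    line and keeps its derivatives inside (0,1). *)
Lemma wnull_pu (F : set V) : wnull usphere F -> purely_unrectifiable F.
Proof.
move=> nF g [[L Lg] [c c0 cg]].
have L0 : 0 <= L.
  have := Lg 0 1; rewrite !in_itv/= !lexx ler01 sub0r normrN normr1 mulr1 => /(_ isT isT).
  exact: le_trans (enorm_ge0 _).
have lg : lipc (g \o clamp 1).
  exists L => s t i; apply: (@le_trans _ _ (L * `|clamp 1 s - clamp 1 t|)); last first.
    by rewrite ler_wpM2l// (clamp_lip ler01).
  apply: le_trans (Lg _ _ _ _); rewrite ?in_itv/=; [|exact: (clamp_itv ler01)..].
  by apply: le_trans (coord_le_enorm _ i); rewrite !mxE.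
apply: negligibleS (negligibleU (negligibleU cg negligible01) (nF _ lg)).
move=> t [/=]; rewrite in_itv/= => t01 Fg.
have [->|tn0] := eqVneq t 0; first by left; right; left.
have [->|tn1] := eqVneq t 1; first by left; right; right.
have [H|H] := pselect (derivable g t 1 /\ c <= enorm ('D_1 g t)); last first.
  by left; left => /= H'; apply: H; apply: H'; rewrite inE/= in_itv.
right; split => //=; first by rewrite (clamp_id ler01).
case: H => /derivable_hasder; set w := 'D_1 g t => gw cw.
have w0 : 0 < enorm w by lra.
exists (enorm w), ((enorm w)^-1 *: w); split=> //.
  by rewrite /usphere/= enormZ ger0_norm ?invr_ge0 ?enorm_ge0// mulVf// gt_eqF.
rewrite scalerA divff ?gt_eqF// scale1r => e e0.
have [r r0 gr] := gw e e0.
have t0 : 0 < t by rewrite lt_neqAle eq_sym tn0; case/andP: t01.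
have t1 : t < 1 by rewrite lt_neqAle tn1; case/andP: t01.
exists (Num.min r (Num.min t (1 - t))); first by rewrite !lt_min r0 t0/=; lra.
move=> s; rewrite !lt_min => /andP[sr]; rewrite !ltr_norml => st i.
by rewrite /= (clamp_id ler01 (t := t))// (clamp_id ler01); [exact: gr|lra].
Qed.

End PU.

                                                         

(** * Monotonicity from almost everywhere information, and limits along ultrafilters *)

Section Noninc.
Context {R : realType} {d : nat}.
Notation V := 'rV[R]_d.
Notation mu := (@lebesgue_measure R).

(** The supremum of the points t with [H t <= H a] belongs to that set and cannot be smaller than
    [b]. *)
Lemma locally_nonincreasing (H : R -> R) (a b : R) : a <= b ->
  (forall t, a <= t <= b -> exists2 r, 0 < r & forall s, a <= s <= b -> `|s - t| < r ->
     (s <= t -> H t <= H s) /\ (t <= s -> H s <= H t)) -> H b <= H a.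
Proof.
move=> ab loc; pose S := [set t | a <= t <= b /\ H t <= H a].
have Sa : S a by split; rewrite ?lexx.
have Sub : ubound S b by move=> t [/andP[]].
have Ssup : has_sup S by split; [exists a|exists b].
pose c := sup S.
have ac : a <= c by apply: ub_le_sup => //; exact: Ssup.2.
have cb : c <= b by apply: ge_sup => //; exact: Ssup.1.
have [r r0 Hr] := loc c ltac:(lra).
have [t [tab Ht] ct] := sup_adherent r0 Ssup; rewrite -/c in ct.
have tc : t <= c by apply: ub_le_sup => //; exact: Ssup.2.
have tr : `|t - c| < r by rewrite ltr_norml; lra.
have [/(_ tc) Hc _] := Hr t tab tr.
have [cbl|] := ltP c b; last by move=> bc; (have -> : b = c by lra); exact: le_trans Ht.
pose s := Num.min b (c + r / 2).
have s1 : s <= b by rewrite ge_min lexx.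
have s2 : s <= c + r / 2 by rewrite ge_min lexx orbT.
have s3 : c < s by rewrite lt_min cbl ltrDl divr_gt0.
have [_ /(_ (ltW s3)) Hs] := Hr s ltac:(lra) ltac:(rewrite ltr_norml; lra).
suff : s <= c by lra.
apply: ub_le_sup; first exact: Ssup.2.
by split; [lra|exact: le_trans Hs (le_trans Hc Ht)].
Qed.

Lemma null_open_cover (N : set R) (e : R) : 0 < e -> mu.-negligible N ->
  exists U, [/\ open U, N `<=` U & (mu U <= e%:E)%E].
Proof.
move=> e0 [B [mB B0 NB]].
have [|U [oU BU UB]] := lebesgue_regularity_outer mB _ e0.
  by rewrite [X in (X < _)%E]B0 ltry.
exists U; split=> //; first exact: subset_trans BU.
have mU : measurable U by exact: open_measurable.
have mUB : measurable (U `\` B) by exact: measurableD.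
rewrite -(setDUK BU) (measureU _ mB mUB) ?setDIK//.
by rewrite [X in (X + _ <= _)%E]B0 add0e; exact: ltW.
Qed.

(** [D] can rise only at times in [E], and there at most at twice the speed of [g], which is zero
    outside a null set. The null set is enclosed in an open [U] of small measure, and a correction
    growing with the measure of [U] below t absorbs the rise inside [U]. *)
Lemma noninc_ae (D : R -> R) (g : R -> V) (E : set R) (L : R) : 0 <= L ->
  (forall s t, enorm (g s - g t) <= L * `|s - t|) ->
  (forall s t, 0 <= s -> s <= t -> t <= 1 -> D t - D s <= 2 * enorm (g t - g s)) ->
  (forall t, 0 <= t <= 1 -> ~ E t -> exists2 r, 0 < r & forall s u,
     0 <= s -> s <= u -> u <= 1 -> `|s - t| < r -> `|u - t| < r -> D u <= D s) ->
  mu.-negligible [set t | [/\ 0 <= t <= 1, E t & ~ hasder g t 0]] ->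
  D 1 <= D 0.
Proof.
move=> L0 gL D2 DE nN.
apply/ler_addgt0Pr => e e0.
pose C : R := 2 * d%:R + 2 * L + 1.
have d0 : 0 <= d%:R :> R by [].
have C0 : 0 < C by rewrite /C; lra.
pose h := e / C.
have h0 : 0 < h by rewrite divr_gt0.
have [U [oU NU Uh]] := null_open_cover h0 nN.
have mU : measurable U by exact: open_measurable.
pose m t := fine (mu (U `&` `[0, t]%classic)).
have mUI t : measurable (U `&` `[0, t]%classic) by exact: measurableI.
have mfin t : mu (U `&` `[0, t]%classic) \is a fin_num.
  rewrite ge0_fin_numE//; apply: (@le_lt_trans _ _ (mu U)); last first.
    exact: le_lt_trans Uh (ltry _).
  by apply: le_measure; rewrite ?inE; [exact: mUI|exact: mU|exact: subIsetl].
have m0 t : 0 <= m t by rewrite fine_ge0.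
have mh t : m t <= h.
  rewrite -lee_fin fineK//; apply: le_trans Uh.
  by apply: le_measure; rewrite ?inE; [exact: mUI|exact: mU|exact: subIsetl].
have m_le s t : s <= t -> m s <= m t.
  move=> st; rewrite -lee_fin !fineK//; apply: le_measure; rewrite ?inE; [exact: mUI..|].
  by apply: setIS; apply: subset_itvl; rewrite bnd_simp.
have m_U s t : 0 <= s -> s <= t -> `]s, t]%classic `<=` U -> t - s <= m t - m s.
  move=> s0 st stU.
  suff : ((m s)%:E + (t - s)%:E <= (m t)%:E)%E by rewrite -EFinD lee_fin; lra.
  rewrite !fineK//.
  have -> : (t - s)%:E = mu `]s, t]%classic.
    rewrite lebesgue_measure_itv/= lte_fin; case: ltP => // ts.
    by (have -> : t = s by lra); rewrite subrr.
  rewrite -measureU//; [|exact: mUI|]; last first.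
    by apply/seteqP; split=> // x /= [[_]]; rewrite !in_itv/= => h1 h2; lra.
  apply: le_measure; rewrite ?inE; [apply: measurableU => //; exact: mUI|exact: mUI|].
  move=> x [[Ux]|]; rewrite /= !in_itv/= => h1; split=> //=.
  - lra.
  - by apply: stU; rewrite /= in_itv/=.
  - lra.
(* The linear term pays for points of [E] where the derivative of [g] is 0, the term with [m] for
   points of [U]. Altogether the corrections amount to at most 2 * d * h + 2 * L * h < e. *)
pose H t := D t - 2 * (d%:R * h) * t - 2 * L * m t.
have dh : 0 <= d%:R * h by rewrite mulr_ge0// ltW.
have key t : 0 <= t <= 1 -> exists2 r, 0 < r & forall s, 0 <= s <= 1 -> `|s - t| < r ->
     (s <= t -> H t <= H s) /\ (t <= s -> H s <= H t).
  move=> /[dup] t01 /andP[t0 t1]; have [Et|nEt] := pselect (E t); last first.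
    have [r r0 Dr] := DE t t01 nEt; exists r => // s /andP[s0 s1] sr.
    have tr : `|t - t| < r by rewrite subrr normr0.
    split=> st.
      have := Dr s t s0 st t1 sr tr; have := m_le _ _ st.
      by rewrite /H; clear -L0 dh st; nra.
    have := Dr t s t0 st s1 tr sr; have := m_le _ _ st.
    by rewrite /H; clear -L0 dh st; nra.
  have [Ut|nUt] := pselect (U t).
    have [r /= r0 rU] := (nbhs_ballP _ _).1 (open_nbhs_nbhs (conj oU Ut)).
    have sub s u : s <= u -> `|s - t| < r -> `|u - t| < r -> `]s, u]%classic `<=` U.
      move=> su; rewrite !ltr_norml => sr ur x /=; rewrite in_itv/= => xs.
      by apply: rU; rewrite /ball/= ltr_norml; lra.
    exists r => // s /andP[s0 s1] sr; have tr : `|t - t| < r by rewrite subrr normr0.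
    split=> st.
      have := m_U _ _ s0 st (sub _ _ st sr tr).
      have := D2 s t s0 st t1; have := gL t s.
      rewrite (ger0_norm (_ : 0 <= t - s)) ?subr_ge0//.
      by rewrite /H; clear -L0 dh st; nra.
    have := m_U _ _ t0 st (sub _ _ st tr sr).
    have := D2 t s t0 st s1; have := gL s t.
    rewrite (ger0_norm (_ : 0 <= s - t)) ?subr_ge0//.
    by rewrite /H; clear -L0 dh st; nra.
  have gt0 : hasder g t 0 by apply: contrapT => ng; apply: nUt; apply: NU.
  have [r r0 gr] := gt0 h h0; exists r => // s /andP[s0 s1] sr.
  have gst : enorm (g s - g t) <= d%:R * h * `|s - t|.
    rewrite -mulrA; apply: enorm_le_coord => i; have := gr s sr i.
    by rewrite !mxE mulr0 subr0.
  split=> st.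
    have := D2 s t s0 st t1; have := m_le _ _ st.
    move: gst; rewrite enormC (ler0_norm (_ : s - t <= 0)) ?subr_le0//.
    by rewrite /H; clear -L0 dh st; nra.
  have := D2 t s t0 st s1; have := m_le _ _ st.
  move: gst; rewrite (ger0_norm (_ : 0 <= s - t)) ?subr_ge0//.
  by rewrite /H; clear -L0 dh st; nra.
have := locally_nonincreasing ler01 key; rewrite /H => H10.
have := m0 0; have := mh 1 => m1 m00.
have eE : e = 2 * (d%:R * h) + 2 * L * h + h.
  by have -> : e = C * h; [rewrite /h; field; rewrite gt_eqF|rewrite /C; ring].
nra.
Qed.

(** This replaces the extraction of subsequences: one ultrafilter makes bounded quantities converge
    at all times at once, without any continuity in time. *)
Lemma ultra_cvg (G : set_system nat) (a : nat -> R) (M : R) : UltraFilter G ->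
  (forall n, `|a n| <= M) ->
  exists l : R, forall e, 0 < e -> G [set n | `|l - a n| < e].
Proof.
move=> UG aM.
have cM := @segment_compact R (-M) M.
have [|l [_ cl]] := cM (a @ G) _.
  by apply: (@filterE _ G) => n; rewrite /= in_itv/= -ler_norml; exact: aM.
exists l => e e0.
have [//|nG] := in_ultra_setVsetC [set n | `|l - a n| < e] UG.
have [x [/= nx lx]] : ([set x | ~ `|l - x| < e] `&` ball l e) !=set0.
  apply: cl; [exact: nG|exact: nbhsx_ballx].
by [].
Qed.

End Noninc.

                                                            

(** * Paths that earn value near a closed set *)

Section Traj.
Context {R : realType} {d : nat} (i0 : 'I_d).
Notation V := 'rV[R]_d.
Implicit Types (K : set V) (f : V -> R) (g : R -> V) (S : R -> R).

Lemma enorm_eq0 (x : V) : enorm x = 0 -> x = 0.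
Proof.
move=> x0; apply/rowP => i; rewrite mxE; apply/eqP; rewrite -normr_le0 -x0.
exact: coord_le_enorm.
Qed.

Lemma cube_dist (x y : V) : cube x -> cube y -> enorm (x - y) <= d%:R.
Proof.
move=> cx cy; rewrite -[leRHS]mulr1; apply: enorm_le_coord => i; rewrite !mxE.
by have := cx i; have := cy i; rewrite ler_norml; lra.
Qed.

Lemma cube_convex (x y : V) (a : R) : cube x -> cube y -> 0 <= a <= 1 ->
  cube (x + a *: (y - x)).
Proof.
by move=> cx cy a01 i; have := cx i; have := cy i; rewrite !mxE; nra.
Qed.

Definition nearset K n (p : V) := exists2 k, K k & enorm (p - k) < n.+1%:R^-1.

                                                                             
                                                                              
                                                                         
(** [S t] is the value held at time t on the path [g]. It grows at most at rate 7/8 of the motion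
    along coordinate [i0], less a running cost 1/8 that bounds the duration of profitable paths.
    Away from the 1/(n+1)-neighbourhood of [K] it must drop by at least the displacement, so that no
    profit over a 1-Lipschitz [f] arises there. *)
Record traj K n f g S (T : R) : Prop := Traj {
  traj_T : 0 <= T;
  traj_S0 : S 0 = f (g 0);
  traj_cube : forall t : R, 0 <= t -> t <= T -> cube (g t);
  traj_lip : forall s t : R, 0 <= s -> s <= t -> t <= T -> enorm (g t - g s) <= t - s;
  traj_up : forall s t : R, 0 <= s -> s <= t -> t <= T ->
    S t - S s <= 7 / 8 * (g t - g s) ord0 i0 - 1 / 8 * (t - s);
  traj_off : forall s t : R, 0 <= s -> s <= t -> t <= T ->
    (forall u : R, s <= u -> u <= t -> ~ nearset K n (g u)) ->
    S t - S s <= - enorm (g t - g s) }.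

Definition trval K n f (x : V) (a : R) := exists g S T,
  [/\ traj K n f g S T, g T = x & S T = a].

Lemma trval_start K n f x : cube x -> trval K n f x (f x).
Proof.
move=> cx; exists (fun=> x), (fun=> f x), 0; split=> //; split=> //.
- by move=> s t s0 st t0; rewrite subrr enorm0; lra.
- by move=> s t s0 st t0; rewrite !subrr mxE; lra.
- by move=> s t *; rewrite !subrr enorm0 oppr0.
Qed.

Lemma trval_extend K n f x a (u : V) (r c : R) : trval K n f x a ->
  0 <= r -> enorm u <= 1 -> (forall t : R, 0 <= t -> t <= r -> cube (x + t *: u)) ->
  c <= 7 / 8 * u ord0 i0 - 1 / 8 ->
  (c <= -1 \/ forall t : R, 0 < t -> t <= r -> nearset K n (x + t *: u)) ->
  trval K n f (x + r *: u) (a + c * r).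
Proof.
move=> [g [S [T [[T0 S0 gc gl gu go] <- <-]]]] r0 u1 cu cle alt.
pose g' t := if t <= T then g t else g T + (t - T) *: u.
pose S' t := if t <= T then S t else S T + c * (t - T).
have cT : cube (g T) by apply: gc.
have uu (t : R) : 0 <= t -> enorm (t *: u) <= t.
  by move=> t0; rewrite enormZ (ger0_norm t0); nra.
exists g', S', (T + r); split; last 2 first.
- rewrite /g'; case: ifPn => [Tr|_]; last by congr (_ + _ *: _); ring.
  by (have -> : r = 0 by lra); rewrite addr0 scale0r addr0.
- rewrite /S'; case: ifPn => [Tr|_]; last by ring.
  by (have -> : r = 0 by lra); rewrite mulr0 !addr0.
split.
- lra.
- by rewrite /S' /g' T0.
- move=> t t0 tT; rewrite /g'; case: ifPn => [/gc|]; first exact.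
  by rewrite -ltNge => Tt; apply: cu; lra.
- move=> s t s0 st tT; rewrite /g'; have [sT|sT] := leP s T; have [tT'|tT'] := leP t T.
  + exact: gl.
  + rewrite (_ : _ - _ = (g T - g s) + (t - T) *: u); last by rewrite addrAC.
    have := ler_enormD (g T - g s) ((t - T) *: u); have := gl s T s0 sT (lexx T).
    by have := uu (t - T) ltac:(lra); lra.
  + lra.
  + rewrite (_ : _ - _ = (t - s) *: u); first by apply: uu; lra.
    by apply/rowP => i; rewrite !mxE; ring.
- move=> s t s0 st tT; rewrite /g' /S'; have [sT|sT] := leP s T; have [tT'|tT'] := leP t T.
  + exact: gu.
  + have := gu s T s0 sT (lexx T); rewrite !mxE.
    by have := ler_wpM2l (_ : 0 <= t - T) cle => /(_ ltac:(lra)); nra.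
  + lra.
  + have := ler_wpM2l (_ : 0 <= t - s) cle => /(_ ltac:(lra)).
    by rewrite !mxE; nra.
- move=> s t s0 st tT; rewrite /g' /S'; have [sT|sT] := leP s T; have [tT'|tT'] := leP t T.
  + move=> far; apply: go => // w sw wt; have := far w sw wt.
    by rewrite ifT//; lra.
  + move=> far; case: alt => [c1|nr]; last first.
      have := far t st (lexx t); rewrite leNgt tT'/= => nt; exfalso; apply: nt.
      by apply: nr; lra.
    have : S T - S s <= - enorm (g T - g s).
      by apply: go => // w sw wT; have := far w sw ltac:(lra); rewrite wT.
    rewrite (_ : g T + _ - _ = (g T - g s) + (t - T) *: u); last by rewrite addrAC.
    have := ler_enormD (g T - g s) ((t - T) *: u).
    by have := uu (t - T) ltac:(lra); nra.
  + lra.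
  + move=> far; case: alt => [c1|nr]; last first.
      have := far t st (lexx t); rewrite leNgt tT'/= => nt; exfalso; apply: nt.
      by apply: nr; lra.
    rewrite (_ : g T + _ - _ = (t - s) *: u); last by apply/rowP => i; rewrite !mxE; ring.
    by have := uu (t - s) ltac:(lra); nra.
Qed.

(** Moving in a straight line at rate -1 is always allowed; this makes the supremum of the
    attainable values 1-Lipschitz. *)
Lemma trval_move K n f x y a : cube x -> cube y -> trval K n f x a ->
  trval K n f y (a - enorm (x - y)).
Proof.
move=> cx cy vx; rewrite enormC.
have [/[dup] /enorm_eq0/subr0_eq -> ->|nz] := eqVneq (enorm (y - x)) 0; first by rewrite subr0.
have r0 : 0 < enorm (y - x) by rewrite lt_neqAle eq_sym nz enorm_ge0.
set r := enorm (y - x) in nz r0 *.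
pose u := r^-1 *: (y - x).
have u1 : enorm u = 1 by rewrite enormZ -/r ger0_norm ?invr_ge0 ?ltW// mulVf.
have -> : y = x + r *: u by rewrite scalerA divff// scale1r addrC subrK.
rewrite -mulN1r; apply: trval_extend => //; first exact: ltW.
- by rewrite u1.
- move=> t t0 tr; rewrite scalerA; apply: cube_convex => //.
  by rewrite mulr_ge0 ?invr_ge0 ?(ltW r0)//= ler_pdivrMr// mul1r.
- have := coord_le_enorm u i0; rewrite u1 ler_norml; lra.
- by left.
Qed.

Definition ei : V := delta_mx ord0 i0.

Lemma enorm_ei : enorm ei = 1.
Proof.
rewrite /enorm (bigD1 i0)//= big1 ?addr0 => [|i ni].
  by rewrite mxE !eqxx expr1n sqrtr1.
by rewrite mxE (negbTE ni) andbF expr0n.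
Qed.

(** Close to [K], motion along the coordinate vector earns 7/8 - 1/8 = 3/4 per unit; this is the
    source of steepness. *)
Lemma trval_near K n f x a r : K x -> 0 <= r -> r < n.+1%:R^-1 -> cube x ->
  cube (x + r *: ei) -> trval K n f x a ->
  trval K n f (x + r *: ei) (a + 3 / 4 * r).
Proof.
move=> Kx r0 rn cx cr vx; apply: trval_extend => //.
- by rewrite enorm_ei.
- move=> t t0 tr i; have := cx i; have := cr i; rewrite !mxE.
  by rewrite eqxx/=; case: (i == i0) => /=; rewrite ?mulr1 ?mulr0 ?addr0; lra.
- by rewrite mxE !eqxx mulr1; lra.
- right=> t t0 tr; exists x => //; rewrite addrAC subrr add0r enormZ enorm_ei mulr1.
  by rewrite ger0_norm ?(ltW t0)//; exact: le_lt_trans tr rn.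
Qed.

End Traj.

(** * The profit is small when the neighbourhood is thin *)

Section Approx.
Context {R : realType} {d : nat} (i0 : 'I_d).
Notation V := 'rV[R]_d.
Implicit Types (K : set V) (f : V -> R).

Lemma cube0 : cube (0 : V).
Proof. by move=> i; rewrite mxE lexx ler01. Qed.

Lemma ball_enorm (x y : V) (r : R) : enorm (x - y) < r -> ball x r y.
Proof. by move=> xy; rewrite -ball_normE /=; exact: le_lt_trans (norm_le_enorm _) xy. Qed.

Lemma notin_closed K (x : V) : closed K -> ~ K x ->
  exists2 r : R, 0 < r & forall k, K k -> r <= enorm (x - k).
Proof.
move=> cK nKx.
have : nbhs x (~` K) by apply: open_nbhs_nbhs; split => //; exact: closed_openC.
move=> /nbhs_ballP[r /= r0 rK]; exists r => // k Kk.
by rewrite leNgt; apply/negP => /ball_enorm/rK.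
Qed.

(** Paths with profit above [e] for every n would have a limit path with profit at least [e]. Off
    [K] its profit cannot grow, and on [K] its derivative vanishes almost everywhere, against
    [noninc_ae]. *)
Lemma trval_approx K f (e : R) : closed K -> wnull usphere K -> Lip1 f -> 0 < e ->
  exists n, forall x a, trval i0 K n f x a -> a <= f x + e.
Proof.
move=> clK nK Lf e0; apply: contrapT => /forallNP H.
have pick n : exists z : (R -> V) * (R -> R) * R,
    traj i0 K n f z.1.1 z.1.2 z.2 /\ f (z.1.1 z.2) + e < z.1.2 z.2.
  have /existsNP[x /existsNP[a /not_implyP[[g [S [T [tr gT ST]]]] /negP]]] := H n.
  by rewrite -ltNge -gT -ST => ?; exists (g, S, T).
have [z zP] := choice pick.
pose gam n := (z n).1.1; pose S n := (z n).1.2; pose T n := (z n).2.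
have tr n : traj i0 K n f (gam n) (S n) (T n) by have [] := zP n.
have gain n : f (gam n (T n)) + e < S n (T n) by have [] := zP n.
have d0 : 0 <= d%:R :> R by [].
(* A bound for the durations: the value changes by at least -d, the coordinate contributes at most
   7/8, and the running cost is T / 8. *)
pose La : R := 8 * (d%:R + 1).
have La0 : 0 < La by rewrite /La; lra.
have T0 n : 0 <= T n by exact: traj_T (tr n).
have cu n t : 0 <= t -> t <= T n -> cube (gam n t) by exact: traj_cube (tr n) t.
have fc x : cube x -> `|f x| <= `|f 0| + d%:R.
  move=> cx; rewrite -[X in `|X|](subrK (f 0)) (le_trans (ler_normD _ _))// addrC lerD2l.
  by rewrite (le_trans (Lf _ _ cx cube0))// cube_dist//; exact: cube0.
have TLa n : T n <= La.
  have := traj_up (tr n) (lexx 0) (T0 n) (lexx _); rewrite (traj_S0 (tr n)) !mxE.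
  have c0 := cu n 0 (lexx 0) (T0 n); have cT := cu n _ (T0 n) (lexx _).
  have := Lf _ _ c0 cT; rewrite ler_norml; have := cube_dist c0 cT.
  by have := gain n; have := c0 i0; have := cT i0; rewrite /La; lra.
(* All paths are reparametrised over [0,1] with the common Lipschitz constant [La], resting at the
   endpoint once it is reached. *)
pose cl n (t : R) := clamp (T n) (La * t).
have cl0T n t : 0 <= cl n t <= T n.
  exact: clamp_itv.
have cl_mono n s t : s <= t -> 0 <= cl n t - cl n s <= La * (t - s).
  move=> st; have : La * s <= La * t by rewrite ler_pM2l.
  by rewrite mulrBr; exact: clamp_mono.
have cl_le n s t : `|cl n s - cl n t| <= La * `|s - t|.
  apply: le_trans (clamp_lip (T0 n) _ _) _.
  by rewrite -mulrBr normrM (gtr0_norm La0).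
have cl0 n : cl n 0 = 0.
  by rewrite /cl mulr0 clamp_le0.
have cl1 n : cl n 1 = T n.
  by rewrite /cl mulr1 clamp_geT.
pose gn n t := gam n (cl n t); pose sn n t := S n (cl n t).
have gnc n t : cube (gn n t) by have /andP[] := cl0T n t; exact: cu.
have gamL n u v : 0 <= u <= T n -> 0 <= v <= T n ->
    enorm (gam n u - gam n v) <= `|u - v|.
  move=> /andP[u0 uT] /andP[v0 vT]; have [uv|/ltW vu] := leP u v.
    by rewrite enormC distrC ger0_norm ?subr_ge0//; exact: (traj_lip (tr n)).
  by rewrite ger0_norm ?subr_ge0//; exact: (traj_lip (tr n)).
have gnL n s t : enorm (gn n s - gn n t) <= La * `|s - t|.
  by apply: le_trans (cl_le n s t); apply: gamL.
have sn_up n s t : s <= t -> sn n t - sn n s <= enorm (gn n t - gn n s).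
  move=> st; have /andP[h1 _] := cl_mono n _ _ st; rewrite subr_ge0 in h1.
  have /andP[h2 _] := cl0T n s; have /andP[_ h3] := cl0T n t.
  have := traj_up (tr n) h2 h1 h3.
  rewrite -/(sn n t) -/(sn n s) -/(gn n t) -/(gn n s).
  have := coord_le_enorm (gn n t - gn n s) i0; rewrite ler_norml.
  by have := enorm_ge0 (gn n t - gn n s); clear -h1; lra.
have snB n t : `|sn n t| <= `|f 0| + d%:R + d%:R.
  have /andP[h h'] := cl0T n t.
  have c0 := cu n 0 (lexx 0) (T0 n); have cT := cu n _ (T0 n) (lexx _).
  have := traj_up (tr n) (lexx 0) h h'.
  have := traj_up (tr n) h h' (lexx _).
  rewrite (traj_S0 (tr n)) -/(sn n t) -/(gn n t) => u1 u2.
  have := coord_le_enorm (gam n (T n) - gn n t) i0; rewrite ler_norml.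
  have := coord_le_enorm (gn n t - gam n 0) i0; rewrite ler_norml.
  have := cube_dist cT (gnc n t); have := cube_dist (gnc n t) c0.
  have := fc _ c0; have := fc _ cT; rewrite !ler_norml; have := gain n.
  by clear -e0 u1 u2 h h'; lra.
have [G [UG ooG]] := ultraFilterLemma eventually_filter.
have FG : ProperFilter G := @ultra_proper _ _ UG.
have /choice[l lP] : forall q : R * 'I_d, exists l : R,
    forall h, 0 < h -> G [set n | `|l - gn n q.1 ord0 q.2| < h].
  move=> q; apply: (ultra_cvg (M := 1)) => n.
  by have := gnc n q.1 q.2; rewrite ler_norml; lra.
have /choice[s sP] : forall t : R, exists l : R,
    forall h, 0 < h -> G [set n | `|l - sn n t| < h].
  by move=> t; apply: ultra_cvg => n; exact: snB.
pose g t : V := \row_i l (t, i).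
have close t (h : R) : 0 < h -> G [set n | enorm (gn n t - g t) < h /\ `|s t - sn n t| < h].
  move=> h0; pose h' := h / (d%:R + 1).
  have h'0 : 0 < h' by rewrite divr_gt0//; lra.
  have hE : h = (d%:R + 1) * h' by rewrite /h'; field; rewrite gt_eqF//; lra.
  apply: filterI; last exact: sP.
  have : \forall n \near G, forall i, `|l (t, i) - gn n t ord0 i| < h'.
    by apply: filter_forall => i; exact: (lP (t, i)).
  apply: filterS => n nh; apply: (@le_lt_trans _ _ (d%:R * h')); last by rewrite hE; lra.
  by apply: enorm_le_coord => i; rewrite !mxE distrC; exact: ltW.
have wit (P : nat -> Prop) : G P -> exists n, P n by exact: filter_ex.
have gL u t : enorm (g u - g t) <= La * `|u - t|.
  apply/ler_addgt0Pr => h h0; have h2 : 0 < h / 2 by rewrite divr_gt0.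
  have [n [[c1 _] [c2 _]]] := wit _ (filterI (close u _ h2) (close t _ h2)).
  have := ler_enorm_trans (gn n u) (g u) (g t).
  have := ler_enorm_trans (gn n t) (gn n u) (g t); rewrite (enormC (g u) (gn n u)).
  by have := gnL n u t; clear -c1 c2; lra.
have gc t : cube (g t).
  move=> i; have key (h : R) : 0 < h -> - h <= g t ord0 i <= 1 + h.
    move=> h0; have [n [c1 _]] := wit _ (close t _ h0).
    have := gnc n t i; have := coord_le_enorm (gn n t - g t) i; rewrite !mxE ler_norml.
    lra.
  apply/andP; split; apply/ler_addgt0Pr => h /key; lra.
have s_up u t : u <= t -> s t - s u <= enorm (g t - g u).
  move=> ut; apply/ler_addgt0Pr => h h0; have h2 : 0 < h / 4 by rewrite divr_gt0.
  have [n [[c1 c2] [c3 c4]]] := wit _ (filterI (close u _ h2) (close t _ h2)).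
  have := sn_up n _ _ ut.
  have := ler_enorm_trans (g t) (gn n t) (gn n u).
  have := ler_enorm_trans (g u) (g t) (gn n u); rewrite (enormC (g u) (gn n u)).
  by move: c2 c4; rewrite !ltr_norml; clear -c1 c3; lra.
(* The profit along the limit path: at most 0 at time 0 and at least [e] at time 1. *)
pose D t := s t - f (g t).
have fg u t : `|f (g u) - f (g t)| <= enorm (g u - g t) by apply: Lf.
have fgn n t : `|f (gn n t) - f (g t)| <= enorm (gn n t - g t) by apply: Lf.
have D0 : D 0 <= 0.
  apply/ler_addgt0Pr => h h0; have h2 : 0 < h / 2 by rewrite divr_gt0.
  have [n [c1 c2]] := wit _ (close 0 _ h2).
  have := fgn n 0; have : sn n 0 = f (gn n 0) by rewrite /sn /gn cl0 (traj_S0 (tr n)).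
  by move: c2; rewrite /D ltr_norml ler_norml; lra.
have D1 : e <= D 1.
  apply/ler_addgt0Pr => h h0; have h2 : 0 < h / 2 by rewrite divr_gt0.
  have [n [c1 c2]] := wit _ (close 1 _ h2).
  have := fgn n 1; have := gain n; rewrite -(cl1 n) -/(sn n 1) -/(gn n 1).
  by move: c2; rewrite /D ltr_norml ler_norml; lra.
suff : D 1 <= D 0 by lra.
apply: (@noninc_ae _ _ D g [set t | K (g t)] La (ltW La0) gL).
- move=> u t u0 ut t1; have := s_up _ _ ut; have := fg t u.
  by rewrite /D ler_norml; lra.
(* If the limit path is off [K] at time t, then for suitable large n the approximating paths avoid
   the 1/(n+1)-neighbourhood of [K] around t, and [traj_off] passes to the limit. *)
- move=> t t01 nKt; have [r r0 rK] := notin_closed clK nKt.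
  have r4 : 0 < r / 4 by rewrite divr_gt0.
  exists (r / 4 / La); first by rewrite divr_gt0.
  move=> u v u0 uv v1; rewrite !ltr_pdivlMr// => ur vr.
  suff : s v - s u <= - enorm (g v - g u).
    by have := fg v u; rewrite /D ler_norml; lra.
  apply/ler_addgt0Pr => h h0; have h2 : 0 < h / 4 by rewrite divr_gt0.
  have [N Nr] : exists N, forall n, (N <= n)%N -> n.+1%:R^-1 < r / 4.
    exists (Num.truncn (r / 4)^-1) => n Nn.
    rewrite -[ltRHS]invrK ltf_pV2 ?posrE ?invr_gt0//.
    by apply: lt_le_trans (truncnS_gt _) _; rewrite ler_nat.
  have [n [[[c1 c2] [c3 c4]] [[c5 _] nN]]] := wit _ (filterI (filterI (close u _ h2)
    (close v _ h2)) (filterI (close t _ r4) (ooG _ (nbhs_infty_ge N)))).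
  have /andP[q1 _] := cl_mono n _ _ uv; rewrite subr_ge0 in q1.
  have /andP[q2 _] := cl0T n u; have /andP[_ q3] := cl0T n v.
  have := traj_off (tr n) q2 q1 q3.
  rewrite -/(sn n v) -/(sn n u) -/(gn n v) -/(gn n u).
  have far w : cl n u <= w -> w <= cl n v -> ~ nearset K n (gam n w).
    move=> uw wv [k Kk wk]; have := rK k Kk.
    have := ler_enorm_trans (gn n t) (g t) k; rewrite (enormC (g t) (gn n t)).
    have := ler_enorm_trans (gam n w) (gn n t) k.
    have := gamL n (cl n t) w (cl0T n t).
    rewrite (le_trans q2 uw) (le_trans wv q3) -/(gn n t) => /(_ isT).
    have := Nr n nN; move: wk; set q := n.+1%:R^-1 => wk qr.
    have w1 : `|cl n t - w| <= r / 4.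
      have := cl_le n u t; have := cl_le n v t; rewrite !ler_norml.
      by move: ur vr; rewrite ![_ * La]mulrC; clear -uw wv; lra.
    by clear -r0 c5 wk qr w1; lra.
  move=> /(_ far) key.
  have := ler_enorm_trans (gn n v) (g v) (g u).
  have := ler_enorm_trans (gn n u) (gn n v) (g u); rewrite (enormC (g v) (gn n v)).
  by move: c2 c4; rewrite !ltr_norml; clear -c1 c3 key; lra.
have lg : lipc g.
  exists La => u t i; apply: le_trans (gL u t).
  by have := coord_le_enorm (g u - g t) i; rewrite !mxE.
apply: negligibleS (negligibleU (lipc_hasder lg) (nK g lg)).
move=> t [t01 Kt nd]; have [[w gw]|nw] := pselect (exists w, hasder g t w); last by left.
right; split=> //.
have [w0|wn0] := eqVneq (enorm w) 0; first by case: nd; rewrite -(enorm_eq0 w0).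
have w0 : 0 < enorm w by rewrite lt_neqAle eq_sym wn0 enorm_ge0.
exists (enorm w), ((enorm w)^-1 *: w); split=> //.
  by rewrite /usphere/= enormZ ger0_norm ?invr_ge0 ?enorm_ge0// mulVf.
by rewrite scalerA divff// scale1r.
Qed.

End Approx.

(** * Open dense sets of steep functions and typical nondifferentiability *)

Section Forward.
Context {R : realType} {d : nat} (i0 : 'I_d).
Notation V := 'rV[R]_d.
Notation e0 := (ei i0 : V).
Implicit Types (K : set V) (f : V -> R).

Definition inner (a : R) : set V := [set x | forall i, a <= x ord0 i <= 1 - a].

Lemma closed_inner a : closed (inner a).
Proof.
have -> : inner a = [set v : V | forall i, `[a, 1 - a]%classic (v ord0 i)].
  by apply/seteqP; split=> v /= H i; have := H i; rewrite in_itv.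
apply: compact_closed; first exact: norm_hausdorff.
by apply: (@rV_compact R d (fun=> `[a, 1 - a]%classic)) => i; exact: segment_compact.
Qed.

Lemma open_cube_inner x : open_cube x -> exists2 r, 0 < r & inner r x.
Proof.
move=> ox.
have [|i|r r0 rP] := @ord_min_radius R d (fun i r => r <= x ord0 i <= 1 - r).
- by move=> i r r' r'0 r'r; lra.
- have := ox i => xi; exists (Num.min (x ord0 i) (1 - x ord0 i)).
    by rewrite lt_min; lra.
  by rewrite ge_min lexx/= lerBrDl -lerBrDr ge_min lexx orbT.
by exists r.
Qed.

Lemma inner_cube a x : 0 <= a -> inner a x -> cube x.
Proof. by move=> a0 ix i; have := ix i; lra. Qed.

Lemma inner_shift a x r : 0 <= r -> r <= a -> inner a x -> cube (x + r *: e0).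
Proof.
move=> r0 ra ix i; have := ix i; rewrite !mxE eqxx/=.
by case: (i == i0) => /=; rewrite ?mulr1 ?mulr0 ?addr0; lra.
Qed.

(** The approximant is the supremum of the values attainable at x. It is at least [f] by the trivial
    path, at most f + e/2 by [trval_approx], 1-Lipschitz by [trval_move] and steep at [K] by
    [trval_near]. *)
Lemma steep_approx K a f (e c : R) : closed K -> wnull usphere K -> 0 < a ->
  K `<=` inner a -> Lip1 f -> 0 < e -> 0 < c ->
  exists g, exists2 r, [/\ Lip1 g, unif_close e f g, 0 < r & r < c] &
    forall x, K x -> cube (x + r *: e0) /\ 3 / 4 * r <= g (x + r *: e0) - g x.
Proof.
move=> cK nK a0 Ka Lf ep c0.
have e2 : 0 < e / 2 by rewrite divr_gt0.
have [n nP] := trval_approx i0 cK nK Lf e2.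
pose A x := [set b | trval i0 K n f x b].
have Asup x : cube x -> has_sup (A x).
  move=> cx; split; first by exists (f x); exact: trval_start.
  by exists (f x + e / 2) => b; exact: nP.
pose g x := sup (A x).
have gub x b : cube x -> A x b -> b <= g x.
  by move=> cx Ab; apply: ub_le_sup => //; exact: (Asup x cx).2.
have gle x M : cube x -> (forall b, A x b -> b <= M) -> g x <= M.
  by move=> cx AM; apply: ge_sup => //; exact: (Asup x cx).1.
have Lg1 x y : cube x -> cube y -> g x <= g y + enorm (x - y).
  move=> cx cy; apply: gle => // b Ab; rewrite -lerBlDr.
  by apply: gub => //; exact: trval_move.
(* Below [c] as demanded, below [a] to stay in the cube, and below 1/(n+1) to stay in the earning
   zone. *)
pose r := Num.min (Num.min c a) n.+1%:R^-1 / 2.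
have n0 : 0 < n.+1%:R^-1 :> R by rewrite invr_gt0.
have m0 : 0 < Num.min (Num.min c a) n.+1%:R^-1 by rewrite !lt_min c0 a0 n0.
have r0 : 0 < r by rewrite divr_gt0.
have rm : r < Num.min (Num.min c a) n.+1%:R^-1 by rewrite /r; lra.
move: rm; rewrite !lt_min => /andP[/andP[rc ra] rn].
exists g, r; first split=> //.
- move=> x y cx cy; rewrite ler_norml.
  by have := Lg1 x y cx cy; have := Lg1 y x cy cx; rewrite (enormC y); lra.
- move=> x cx; have : f x <= g x by apply: gub => //; exact: trval_start.
  have : g x <= f x + e / 2 by apply: gle => // b; exact: nP.
  by rewrite ltr_norml; lra.
move=> x Kx; have cr : cube (x + r *: e0).
  by apply: inner_shift (Ka _ Kx); rewrite ltW.
have cx : cube x by apply: inner_cube (Ka _ Kx); exact: ltW.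
split=> //; rewrite lerBrDr; rewrite addrC -lerBrDr; apply: gle => // b Ab.
rewrite lerBrDr; apply: gub => //; apply: trval_near => //; exact: ltW.
Qed.

(** One step [r] serves all of [K], and the margin [h] makes the condition stable under small
    uniform changes. *)
Definition steep K (c : R) : set (V -> R) := [set f | exists r h : R,
  [/\ 0 < r, r < c, 0 < h & forall x, K x ->
     cube (x + r *: e0) /\ r / 2 + h <= f (x + r *: e0) - f x]].

Lemma steep_open K c : K `<=` @cube R d -> rel_open_Lip1 (steep K c).
Proof.
move=> Kc f Lf [r [h [r0 rc h0 H]]]; exists (h / 4); first by rewrite divr_gt0.
move=> g Lg fg; exists r, (h / 2); split=> //; first by rewrite divr_gt0.
move=> x Kx; have [cr fr] := H x Kx; split=> //.
by have := fg _ cr; have := fg _ (Kc _ Kx); rewrite !ltr_norml; lra.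
Qed.

Lemma steep_dense K a c : closed K -> wnull usphere K -> 0 < a ->
  K `<=` inner a -> 0 < c -> dense_Lip1 (steep K c).
Proof.
move=> cK nK a0 Ka c0 f Lf e ep.
have [g [r [Lg fg r0 rc] H]] := steep_approx cK nK a0 Ka Lf ep c0.
exists g; split=> //; exists r, (r / 4); split=> //; first by rewrite divr_gt0.
by move=> x /H[cr gr]; split=> //; lra.
Qed.

Lemma Lip1N f : Lip1 f -> Lip1 (fun x => - f x).
Proof. by move=> Lf x y cx cy; rewrite -opprD normrN; exact: Lf. Qed.

Lemma unif_closeN e f g : unif_close e f g ->
  unif_close e (fun x => - f x) (fun x => - g x).
Proof. by move=> fg x cx; rewrite -opprD normrN; exact: fg. Qed.

Definition steepN K c : set (V -> R) := [set f | steep K c (fun x => - f x)].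

Lemma steepN_open K c : K `<=` @cube R d -> rel_open_Lip1 (steepN K c).
Proof.
move=> Kc f Lf sf; have [h h0 H] := steep_open Kc (Lip1N Lf) sf.
by exists h => // g Lg fg; apply: H; [exact: Lip1N|exact: unif_closeN].
Qed.

Lemma steepN_dense K a c : closed K -> wnull usphere K -> 0 < a ->
  K `<=` inner a -> 0 < c -> dense_Lip1 (steepN K c).
Proof.
move=> cK nK a0 Ka c0 f Lf e ep.
have [g [Lg sg fg]] := steep_dense cK nK a0 Ka c0 (Lip1N Lf) ep.
exists (fun x => - g x); split.
- exact: Lip1N.
- by rewrite /steepN/=; under [fun x => _]eq_fun do rewrite opprK.
- by move=> x cx; have := fg x cx; rewrite -normrN opprD !opprK.
Qed.

(** A derivative along [e0] would have to be both positive and negative. *)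
Lemma steep_nondiff (f : V -> R) x : (forall c, 0 < c -> exists r, [/\ 0 < r, r < c &
    r / 2 <= f (x + r *: e0) - f x]) ->
  (forall c, 0 < c -> exists r, [/\ 0 < r, r < c &
    r / 2 <= f x - f (x + r *: e0)]) -> ~ differentiable f x.
Proof.
move=> up dn df.
have := @diff_derivable _ _ _ f x e0 df => /cvg_ex[l /cvgrPdist_le].
move=> /(_ (1 / 4) ltac:(lra))[c /= c0 H].
have key r : 0 < r -> r < c -> `|r * l - (f (x + r *: e0) - f x)| <= r / 4.
  move=> r0 rc; have := H r; rewrite /= sub0r normrN (gtr0_norm r0) => /(_ rc).
  rewrite gt_eqF// => /(_ isT); rewrite (addrC (r *: _) x) => h.
  have -> : r * l - (f (x + r *: e0) - f x) =
    r * (l - r^-1 * (f (x + r *: e0) - f x)) by field; rewrite gt_eqF.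
  by rewrite normrM (gtr0_norm r0) ler_pM2l// (le_trans h)//; lra.
have [r [r0 rc fr]] := up c c0; have [s [s0 sc fs]] := dn c c0.
have := key r r0 rc; have := key s s0 sc; rewrite !ler_norml => h1 h2.
have : 0 < l * r by nra.
have : l * s < 0 by nra.
by rewrite pmulr_lgt0// pmulr_llt0//; lra.
Qed.

Lemma wnull_residual (A : set V) (F : nat -> set V) : A `<=` @open_cube R d ->
  (forall n, closed (F n)) -> (forall n, wnull usphere (F n)) -> A `<=` \bigcup_n F n ->
  residual_Lip1 (fun f : V -> R => forall x, A x -> ~ differentiable f x).
Proof.
move=> Ao cF nF AF.
pose a m : R := m.+1%:R^-1.
have a0 m : 0 < a m by rewrite invr_gt0.
pose K (q : nat * nat) := F q.1 `&` inner (a q.2).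
have cK q : closed (K q) by apply: closedI => //; exact: closed_inner.
have nK q : wnull usphere (K q) by apply: wnullS (nF q.1) => //; exact: subIsetl.
have Ki q : K q `<=` inner (a q.2) by exact: subIsetr.
have Kc q : K q `<=` @cube R d by move=> x /Ki; apply: inner_cube; exact: ltW.
pose Q (q : nat * nat * nat * bool) := let: (j, m, n, b) := q in
  if b then steep (K (j, m)) (a n) else steepN (K (j, m)) (a n).
(* The indices are a closed set, a distance to the boundary of the cube, a scale and a sign; codes
   of nothing give the whole space. *)
exists (fun k => if unpickle k is Some q then Q q else setT); split.
- move=> k; case: unpickle => [[[[j m] n] [|]]|] /=.
  + exact: steep_open.
  + exact: steepN_open.
  + by move=> f _ _; exists 1.
- move=> k; case: unpickle => [[[[j m] n] [|]]|] /=.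
  + exact: steep_dense (a0 m) _ (a0 n).
  + exact: steepN_dense (a0 m) _ (a0 n).
  + by move=> f Lf e ep; exists f; split=> // x _; rewrite subrr normr0.
move=> f Lf Uf x Ax; have [j _ Fx] := AF x Ax.
have [m im] : exists m, inner (a m) x.
  have [r r0 rP] := open_cube_inner (Ao x Ax).
  exists (Num.truncn r^-1) => i; have := rP i.
  have : a (Num.truncn r^-1) < r.
    exact: inv_truncn_lt.
  by lra.
have Kx : K (j, m) x by [].
have small c : 0 < c -> exists n, a n < c.
  by move=> c0; exists (Num.truncn c^-1); exact: inv_truncn_lt.
apply: steep_nondiff => c /small[n nc].
  have := Uf (pickle (j, m, n, true)); rewrite pickleK => -[r [h [r0 rn h0 H]]].
  by have [_ fr] := H x Kx; exists r; split=> //; [exact: lt_trans nc|lra].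
have := Uf (pickle (j, m, n, false)); rewrite pickleK => -[r [h [r0 rn h0 H]]].
by have [_ fr] := H x Kx; exists r; split=> //; [exact: lt_trans nc|lra].
Qed.

End Forward.

                                    

(** * Sets without countable closed null covers, and their kernels *)

Section Cover.
Context {R : realType} {d : nat}.
Notation V := 'rV[R]_d.
Implicit Types (W S : set V).

Definition coverable W S := exists F : nat -> set V,
  [/\ forall n, closed (F n), forall n, wnull W (F n) & S `<=` \bigcup_n F n].

Lemma coverable0 S : coverable set0 S.
Proof.
exists (fun=> setT); split=> [n|n|x _]; [exact: closedT|exact: wnull0|].
by exists 0%N.
Qed.

Lemma coverableS W1 W2 S1 S2 : W1 `<=` W2 -> S1 `<=` S2 -> coverable W2 S2 ->
  coverable W1 S1.
Proof.
move=> W12 S12 [F [cF nF SF]]; exists F; split=> //.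
  by move=> n; apply: wnullS (nF n).
exact: subset_trans SF.
Qed.

(** The pairwise intersections of the two covers still cover [S], and each is null in both families
    of directions. This lets noncoverability be localised in direction. *)
Lemma coverableU W1 W2 S : coverable W1 S -> coverable W2 S ->
  coverable (W1 `|` W2) S.
Proof.
move=> [F [cF nF SF]] [G [cG nG SG]].
pose q k := odflt (0%N, 0%N) (unpickle k).
exists (fun k => F (q k).1 `&` G (q k).2); split.
- by move=> k; exact: closedI.
- move=> k; apply: wnullU; first by apply: wnullS (nF (q k).1) => //; exact: subIsetl.
  by apply: wnullS (nG (q k).2) => //; exact: subIsetr.
- move=> x Sx; have [i _ Fx] := SF x Sx; have [j _ Gx] := SG x Sx.
  by exists (pickle (i, j)) => //; rewrite /q pickleK.
Qed.

Lemma wnull_set0 W : wnull W set0.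
Proof. by move=> g _; apply: negligibleS (@negligible_set0 _ _ _ _) => t []. Qed.

Lemma coverable_countable (T : countType) W (S : T -> set V) :
  (forall k, coverable W (S k)) -> coverable W [set x | exists k, S k x].
Proof.
move=> /choice[F FP].
pose G n := if unpickle n is Some (k, m) then F k m else set0.
exists G; split.
- by move=> n; rewrite /G; case: unpickle => [[k m]|]; [have [] := FP k|exact: closed0].
- by move=> n; rewrite /G; case: unpickle => [[k m]|]; [have [] := FP k|exact: wnull_set0].
- move=> x [k Sx]; have [_ _ SF] := FP k; have [m _ Fx] := SF x Sx.
  by exists (pickle (k, m)) => //; rewrite /G pickleK.
Qed.

Lemma closure_not_wnull W S : ~ coverable W S -> ~ wnull W (closure S).
Proof.
apply: contra_not => nS; exists (fun=> closure S); split=> //.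
- by move=> _; exact: closed_closure.
- by move=> x Sx; exists 0%N => //; exact: subset_closure.
Qed.

Variable g : (nat -> nat) -> V.

Definition cyl (s : nat -> nat) n := [set t : nat -> nat | forall i, (i < n)%N -> t i = s i].

(** Every nonempty relatively open part of [X] has a noncoverable image: an analogue of a perfect
    kernel for the ideal of coverable sets. *)
Definition hered W (X : set (nat -> nat)) := forall s, X s -> forall n,
  ~ coverable W (g @` (X `&` cyl s n)).

(** As in the Cantor-Bendixson theorem, the pieces of [X] in cylinders with coverable image are
    discarded. There are countably many cylinders, so the discarded part is coverable and no
    cylinder loses its noncoverability. *)
Lemma hered_exists W X : ~ coverable W (g @` X) ->
  exists Y, [/\ Y `<=` X, Y !=set0 & hered W Y].
Proof.
move=> nX; pose Y := [set s | X s /\ forall n, ~ coverable W (g @` (X `&` cyl s n))].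
have cXY : coverable W (g @` (X `\` Y)).
  pose Z (p : seq nat) := g @` (X `&` cyl (nth 0%N p) (size p)).
  have := @coverable_countable _ W (fun p => [set x | Z p x /\ coverable W (Z p)]).
  case=> [p|F [cF nF SF]].
    have [c|nc] := pselect (coverable W (Z p)); first by apply: coverableS c => // x [].
    exists (fun=> set0); split=> [n|n|x [_ //]]; [exact: closed0|exact: wnull_set0].
  exists F; split=> // _ [s [Xs nYs] <-]; apply: SF.
  have /existsNP[n /contrapT cn] : ~ forall n, ~ coverable W (g @` (X `&` cyl s n)).
    by move=> H; apply: nYs.
  exists (mkseq s n).
  have E : cyl (nth 0%N (mkseq s n)) (size (mkseq s n)) = cyl s n.
    apply/seteqP; rewrite size_mkseq; split=> t /= H i ni; have := H i ni;
    by rewrite nth_mkseq.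
  split; last by rewrite /Z E.
  by rewrite /Z E; exists s.
have key (n : nat) s : coverable W (g @` (Y `&` cyl s n)) ->
    coverable W (g @` (X `&` cyl s n)).
  move=> c; have := @coverable_countable bool W (fun b => if b then
     g @` (Y `&` cyl s n) else g @` (X `\` Y)).
  case=> [[]//|F [cF nF SF]]; exists F; split=> // _ [t [Xt st] <-]; apply: SF.
  have [Yt|nYt] := pselect (Y t); first by exists true; exists t.
  by exists false; exists t.
exists Y; split=> [s []//| |s [Xs ns] n]; last by move=> /key; exact: ns.
apply: contrapT => Y0; apply: nX; apply: coverableS cXY => // _ [s Xs <-]; exists s => //.
by split=> // Ys; apply: Y0; exists s.
Qed.

Lemma enorm_closure (S : set V) x (r : R) : 0 < r -> closure S x ->
  exists2 y, S y & enorm (y - x) < r.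
Proof.
move=> r0 clS; pose r' := r / (d%:R + 1).
have d0 : 0 <= d%:R :> R by [].
have r'0 : 0 < r' by rewrite divr_gt0//; lra.
have rE : r = (d%:R + 1) * r' by rewrite /r'; field; rewrite gt_eqF//; lra.
have [y [Sy]] := clS _ (nbhsx_ballx x _ r'0); rewrite -ball_normE/= => xy.
exists y => //; rewrite enormC; apply: le_lt_trans (enorm_le_norm _) _.
by rewrite rE; nra.
Qed.

(** Restricting to a long cylinder brings the image near [x] and fixes the first [m] entries;
    [box_ind] then finds a small box of directions that keeps it noncoverable; finally the kernel is
    taken again. *)
Lemma localize W X x (r k : R) (m : nat) : baire_continuous g -> W `<=` usphere ->
  hered W X -> closure (g @` X) x -> 0 < r -> 0 < k ->
  exists Y W', exists v : V, [/\ Y `<=` X /\ W' `<=` W, W' v,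
    forall (w : V) i, W' w -> `|w ord0 i - v ord0 i| <= k, hered W' Y & Y !=set0 /\
    (forall y, Y y -> enorm (g y - x) < r) /\
    forall y y', Y y -> Y y' -> forall i, (i < m)%N -> y i = y' i].
Proof.
move=> gc Ws hX clx r0 k0; have r2 : 0 < r / 2 by rewrite divr_gt0.
have [_ [s Xs <-] sx] := enorm_closure r2 clx.
have [n ng] := gc s _ r2.
pose N := maxn n m; pose X1 := X `&` cyl s N.
have nX1 : ~ coverable W (g @` X1) by exact: hX.
have [v Wv nv] : exists2 v, W v & ~ coverable
    (W `&` [set w | forall i, `|w ord0 i - v ord0 i| <= k]) (g @` X1).
  apply: contrapT => H; apply: nX1.
  apply: (@box_ind _ _ (fun W => coverable W (g @` X1)) _ k k0).
  - by move=> w i /Ws; exact: usphere_coord.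
  - exact: coverable0.
  - by move=> A B; exact: coverableU.
  - by move=> A B AB; exact: coverableS.
  - by move=> v Wv; apply: contrapT => nv; apply: H; exists v.
have [Y [YX Y0 hY]] := hered_exists nv.
exists Y, (W `&` [set w | forall i, `|w ord0 i - v ord0 i| <= k]), v; split=> //.
- by split; [apply: subset_trans YX _; exact: subIsetl|exact: subIsetl].
- by split=> // i; rewrite subrr normr0 ltW.
- by move=> w i [_]; exact.
split=> //; split.
- move=> y /YX[_ sy]; have := ler_enorm_trans (g s) (g y) x.
  have : enorm (g y - g s) < r / 2.
    by apply: ng => i ni; apply: sy; rewrite leq_max ni.
  by lra.
- move=> y y' /YX[_ sy] /YX[_ sy'] i im.
  by rewrite sy ?sy'// leq_max im orbT.
Qed.

End Cover.

                                         

(** * A density point and a maximal inequality on the line *)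

Section Analysis.
Context {R : realType}.
Notation mu := (@lebesgue_measure R).

(** At a Lebesgue density point, small balls are filled to the proportion 7/8 of their length 2r. *)
Lemma density_ball (E : set R) (l : R) : measurable E -> ~ mu.-negligible E -> 0 < l ->
  exists x, exists2 r, [/\ E x, 0 < r & r < l] &
    ((7 / 4 * r)%:E <= mu (E `&` ball x r))%E.
Proof.
move=> mE nE l0; have [N [mN N0 sN]] := lebesgue_density mE.
have [x Ex nNx] : exists2 x, E x & ~ N x.
  apply: contrapT => H; apply: nE; exists N; split=> // x Ex.
  by apply: contrapT => nNx; apply: H; exists x.
have : (mu (E `&` ball x r) * (mu (ball x r))^-1)%E @[r --> 0^'+] --> 1%E.
  have : ~ ~ ((mu (E `&` ball x r) * (mu (ball x r))^-1)%E @[r --> 0^'+] --> (\1_E x)%:E).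
    by move=> H; apply: nNx; apply: sN.
  by move=> /contrapT; rewrite indicE mem_set.
move=> cE; have h : ((7 / 8)%:E < 1 :> \bar R)%E by rewrite lte_fin; lra.
have H : \forall r \near 0^'+, ((7 / 8)%:E < mu (E `&` ball x r) * (mu (ball x r))^-1)%E.
  apply: (cE [set y | (7 / 8)%:E < y]%E); apply: open_nbhs_nbhs; split=> //.
  exact: open_ereal_gt_ereal.
near ((0 : R)^'+) => r.
have r0 : 0 < r by near: r; exact: nbhs_right_gt.
exists x, r; first by split=> //; near: r; exact: nbhs_right_lt.
have : ((7 / 8)%:E < mu (E `&` ball x r) * (mu (ball x r))^-1)%E by near: r.
rewrite lebesgue_measure_ball; last exact: ltW.
rewrite inver mulrn_eq0/= gt_eqF//.
move=> /ltW; rewrite lee_pdivlMr; last by rewrite mulr2n; lra.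
by rewrite -EFinM => /(le_trans _); apply; rewrite lee_fin mulr2n; lra.
Unshelve. all: by end_near. Qed.

(** The list is not sorted: its first interval separates the others into those to its left and those
    to its right, to which induction on the length applies. *)
Lemma sum_disjoint_increments (q : R -> R) n (s : seq (R * R)) A B : (size s <= n)%N ->
  A <= B -> {in `[A, B] &, {homo q : x y / x <= y}} ->
  (forall p, p \in s -> [/\ A <= p.1, p.1 < p.2 & p.2 <= B]) ->
  uniq s -> (forall p p', p \in s -> p' \in s -> p != p' -> p.2 < p'.1 \/ p'.2 < p.1) ->
  \sum_(p <- s) (q p.2 - q p.1) <= q B - q A.
Proof.
elim: n s A B => [|n IH] s A B.
  rewrite leqn0 size_eq0 => /eqP-> AB hq _ _ _.
  by rewrite big_nil subr_ge0; apply: hq; rewrite ?in_itv/= ?lexx ?AB.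
case: s => [|[a b] s] sn AB hq sAB us ds.
  by rewrite big_nil subr_ge0; apply: hq; rewrite ?in_itv/= ?lexx ?AB.
have [/= Aa ab bB] := sAB _ (mem_head _ _).
have /= /andP[nab us'] := us.
have side p : p \in s -> p.2 < a \/ b < p.1.
  move=> ps; have := ds p (a, b); rewrite inE ps orbT mem_head => /(_ isT isT).
  by apply; apply: contraNneq nab => <-.
rewrite big_cons /= (bigID (fun p => p.2 < a))/=.
have L : \sum_(p <- s | p.2 < a) (q p.2 - q p.1) <= q a - q A.
  rewrite -big_filter; apply: IH.
  - by rewrite size_filter (leq_trans (count_size _ _)).
  - lra.
  - by move=> x y; rewrite !in_itv/= => hx hy; apply: hq; rewrite in_itv/=; lra.
  - move=> p; rewrite mem_filter => /andP[pa ps].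
    by have [] := sAB p; rewrite ?inE ?ps ?orbT//; split=> //; exact: ltW.
  - exact: filter_uniq.
  - move=> p p'; rewrite !mem_filter => /andP[_ ps] /andP[_ ps'].
    by apply: ds; rewrite inE ?ps ?ps' orbT.
have G : \sum_(p <- s | ~~ (p.2 < a)) (q p.2 - q p.1) <= q B - q b.
  rewrite -big_filter; apply: IH.
  - by rewrite size_filter (leq_trans (count_size _ _)).
  - lra.
  - by move=> x y; rewrite !in_itv/= => hx hy; apply: hq; rewrite in_itv/=; lra.
  - move=> p; rewrite mem_filter => /andP[pa ps].
    have [] := sAB p; rewrite ?inE ?ps ?orbT// => h1 h2 h3; split=> //.
    by case: (side p ps) => [|/ltW//]; rewrite (negbTE pa).
  - exact: filter_uniq.
  - move=> p p'; rewrite !mem_filter => /andP[_ ps] /andP[_ ps'].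
    by apply: ds; rewrite inE ?ps ?ps' orbT.
lra.
Qed.

                                                                          
                                                                             
                                           
(** A maximal inequality: points of [E] in the middle half without the property are covered by
    intervals over which [q] grows faster than [z]. A disjoint Vitali subfamily bounds their measure
    in terms of the total growth of [q], and 4b < z makes this too small for the density of [E]. *)
Lemma slow_point (q : R -> R) (E : set R) (c r b z : R) : closed E -> 0 < r -> 0 < b ->
  4 * b < z -> {in `[c - r, c + r] &, {homo q : x y / x <= y}} ->
  q (c + r) - q (c - r) <= b * r -> ((7 / 4 * r)%:E <= mu (E `&` ball c r))%E ->
  exists2 t, E t /\ c - r / 2 <= t <= c + r / 2 & forall s, c - r <= s <= c + r ->
    (t <= s -> q s - q t <= z * (s - t)) /\ (s <= t -> q t - q s <= z * (t - s)).
Proof.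
move=> cE r0 b0 bz hq qb dE; apply: contrapT => H.
have z0 : 0 < z by lra.
pose C := E `&` `[c - r / 2, c + r / 2]%classic.
have cptC : compact C.
  by rewrite /C setIC; apply: compact_closedI => //; exact: segment_compact.
have /choice[f fP] : forall t, exists p : R * R * R, 0 < p.2 /\ (C t ->
    [/\ c - r <= p.1.1 /\ p.1.1 < p.1.2, p.1.2 <= c + r,
      2 * z * p.2 < q p.1.2 - q p.1.1, p.1.2 - p.1.1 < 2 * p.2 &
      p.1.1 <= t <= p.1.2]).
  move=> t; have [Ct|nC] := pselect (C t); last by exists (0, 0, 1).
  have tb : c - r / 2 <= t <= c + r / 2 by case: Ct => _ /=; rewrite in_itv.
  have mk a e : c - r <= a -> a < e -> e <= c + r -> z * (e - a) < q e - q a ->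
      a <= t <= e -> exists p : R * R * R, 0 < p.2 /\ (C t ->
    [/\ c - r <= p.1.1 /\ p.1.1 < p.1.2, p.1.2 <= c + r,
      2 * z * p.2 < q p.1.2 - q p.1.1, p.1.2 - p.1.1 < 2 * p.2 &
      p.1.1 <= t <= p.1.2]).
    move=> ca ae ec zq ate.
    (* 2 * rho is the mean of the length and of the growth divided by z, hence strictly between
       them: the open ball contains the closed interval, and the growth still exceeds 2 * z *
       rho. *)
    pose rho := ((e - a) + (q e - q a) / z) / 4.
    have e1 : e - a < (q e - q a) / z by rewrite ltr_pdivlMr// mulrC.
    have e2 : z * ((q e - q a) / z) = q e - q a by field; rewrite gt_eqF.
    exists (a, e, rho); rewrite /rho /=; split; first by lra.
    move=> _; split=> //; last by lra.
    by set w := (q e - q a) / z in e1 e2 *; nra.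
  have /existsNP[s /not_implyP[sr /not_andP[]/not_implyP[st /negP]]] :
      ~ forall s, c - r <= s <= c + r -> (t <= s -> q s - q t <= z * (s - t)) /\
        (s <= t -> q t - q s <= z * (t - s)).
    by move=> G; apply: H; exists t => //; split=> //; case: Ct.
    rewrite -ltNge => zs; apply: (mk t s) => //; try lra.
    by rewrite lt_neqAle st andbT; apply: contraTneq zs => ->; rewrite !subrr mulr0 ltxx.
  rewrite -ltNge => zs; apply: (mk s t) => //; try lra.
  by rewrite lt_neqAle st andbT; apply: contraTneq zs => ->; rewrite !subrr mulr0 ltxx.
pose a t := (f t).1.1; pose e t := (f t).1.2; pose rho t := (f t).2.
have rho0 t : 0 < rho t by have [] := fP t.
pose B t := ball ((a t + e t) / 2) (rho t).
have inB t u : C t -> a t <= u <= e t -> B t u.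
  move=> Ct ue; have [_ /(_ Ct)[]] := fP t; rewrite -/(a t) -/(e t) -/(rho t).
  by move=> _ _ _ h _; rewrite /B /ball/= ltr_norml; lra.
move: (cptC); rewrite compact_cover => /(_ R C B).
case=> [t _|t Ct|D DC CD]; first exact: ball_open.
  by exists t => //; apply: inB => //; have [_ /(_ Ct)[]] := fP t.
have [||D' [uD' D'D tD' sD']] := @vitali_lemma_finite_cover R _ B _ _ (finmap.enum_fset D).
- by move=> t; exact: is_ball_ball.
- by move=> t; exists ((a t + e t) / 2); exact: ballxx.
have D'C t : t \in D' -> C t by move=> /D'D /DC; rewrite inE.
pose s := [seq (a t, e t) | t <- D'].
have ae t : t \in D' -> a t < e t by move=> /D'C Ct; have [_ /(_ Ct)[[]]] := fP t.
have dis t u : t \in D' -> u \in D' -> t != u -> e t < a u \/ e u < a t.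
  move=> tD uD tu; apply: contrapT => /not_orP[/negP + /negP]; rewrite -!leNgt => h1 h2.
  move/eqP: tu; apply; apply: tD' => //.
  exists (Num.max (a t) (a u)); split; (apply: inB; first exact: D'C);
    rewrite le_max lexx ?orbT/=.
    by rewrite ge_max h1 ltW// ae.
  by rewrite ge_max h2 ltW// ae.
have inj : {in D' &, injective (fun t => (a t, e t))}.
  move=> t u tD uD [h1 h2]; apply: contrapT => /eqP /(dis _ _ tD uD).
  by have := ae t tD; have := ae u uD; rewrite h1 h2; lra.
have S1 : \sum_(p <- s) (q p.2 - q p.1) <= q (c + r) - q (c - r).
  apply: (sum_disjoint_increments (leqnn _)) => //; first lra.
  - move=> p /mapP[t tD ->] /=; have Ct := D'C t tD.
    by have [_ /(_ Ct)[[]]] := fP t.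
  - by rewrite map_inj_in_uniq.
  - move=> p p' /mapP[t tD ->] /mapP[u uD ->] /= tu; apply: dis => //.
    by apply: contra_neq tu => ->.
have S2 : \sum_(t <- D') (2 * z * rho t) <= b * r.
  apply: le_trans qb; apply: le_trans S1; rewrite big_map /=.
  rewrite big_seq [leRHS]big_seq; apply: ler_sum => t tD; have Ct := D'C t tD.
  by have [_ /(_ Ct)[_ _ /ltW]] := fP t.
have M1 : (mu C <= (\sum_(t <- D') (6 * rho t))%:E)%E.
  have mC : measurable C by exact: compact_measurable.
  have sub : C `<=` \big[setU/set0]_(t <- D') ball ((a t + e t) / 2) (3 * rho t).
    move=> x /CD Dx; have [t tD] := sD' x Dx; rewrite /= scale_ballE// => xt.
    by rewrite -bigcup_seq; exists t.
  have mb : measurable (\big[setU/set0]_(t <- D') ball ((a t + e t) / 2) (3 * rho t)).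
    by apply: bigsetU_measurable => t _; exact: measurable_ball.
  apply: (@le_trans _ _ (mu (\big[setU/set0]_(t <- D') ball ((a t + e t) / 2) (3 * rho t)))).
    by apply: le_measure; rewrite ?inE.
  have mbE t : mu (ball ((a t + e t) / 2) (3 * rho t)) = (6 * rho t)%:E.
    rewrite lebesgue_measure_ball; last by rewrite mulr_ge0// ltW.
    by congr (_%:E); rewrite mulr2n; ring.
  elim: (D') => [|t D2 IH]; first by rewrite !big_nil measure0.
  rewrite !big_cons EFinD.
  apply: (le_trans (measureU2 _ _ _)).
  - exact: measurable_ball.
  - by apply: bigsetU_measurable => u _; exact: measurable_ball.
  by apply: leeD => //; rewrite [X in (X <= _)%E](mbE t).
(* Dropping the two outer quarters costs measure [r], so at least 7/4 * r - r = 3/4 * r remains to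
   be covered. *)
have M2 : (mu (E `&` ball c r) <= mu C + r%:E)%E.
  pose L := `](c - r), (c - r / 2)[%classic; pose G := `](c + r / 2), (c + r)[%classic.
  have mC : measurable C by exact: compact_measurable.
  have mE : measurable (E `&` ball c r).
    by apply: measurableI; [exact: closed_measurable|exact: measurable_ball].
  have mLG : measurable (L `|` G) by apply: measurableU; exact: measurable_itv.
  apply: (@le_trans _ _ (mu (C `|` (L `|` G)))).
    apply: le_measure; rewrite ?inE//; first exact: measurableU.
    move=> x [Ex]; rewrite /ball/= ltr_norml => xr.
    rewrite /C /L /G /= !in_itv/=.
    have [h1|h1] := ltP x (c - r / 2); first by right; left; lra.
    have [h2|h2] := ltP (c + r / 2) x; first by right; right; lra.
    by left.
  apply: (le_trans (measureU2 _ _ _)) => //; apply: leeD => //.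
  apply: (le_trans (measureU2 _ _ _)); [exact: measurable_itv..|].
  have lenE u w : u < w -> mu `]u, w[%classic = (w - u)%:E.
    by move=> uw; rewrite lebesgue_measure_itv/= lte_fin uw.
  rewrite [X in (X + _ <= _)%E]lenE; last lra.
  rewrite [X in (_ + X <= _)%E]lenE; last lra.
  by rewrite -!EFinD lee_fin; lra.
have S3 : 3 / 4 * r <= \sum_(t <- D') (6 * rho t).
  rewrite -lee_fin -(leeD2rE (x := r%:E))//.
  apply: (@le_trans _ _ (mu C + r%:E)%E); last by rewrite leeD2rE.
  apply: le_trans M2; apply: le_trans dE.
  by rewrite -EFinD lee_fin; lra.
have : z / 3 * (\sum_(t <- D') (6 * rho t)) <= b * r.
  apply: le_trans S2; rewrite mulr_sumr; apply: ler_sum => t _.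
  by rewrite le_eqVlt; apply/orP; left; apply/eqP; field.
set X := (\sum_(t <- D') (6 * rho t)) in S3 *.
nra.
Qed.

End Analysis.

                                     

(** * Nearly maximal slope forces near differentiability *)

Section Stage.
Context {R : realType} {d : nat}.
Notation V := 'rV[R]_d.
Implicit Types (f h : V -> R) (x y z v : V).

(** The right side is T + w, whose square exceeds the squared norm on the left by w ^ 2. *)
Lemma enorm_add_le v y (T : R) : enorm v = 1 -> 0 < T -> enorm y <= T ->
  enorm (y + T *: v) <= T + dot y v + enorm y ^+ 2 / (2 * T).
Proof.
move=> v1 T0 yT.
have dy : - T <= dot y v.
  by have := normr_dot_le y v; rewrite v1 mulr1 ler_norml; lra.
pose w := dot y v + enorm y ^+ 2 / (2 * T).
have w0 : - T <= w by rewrite (le_trans dy)// lerDl divr_ge0 ?sqr_ge0// mulr_ge0// ltW.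
have Tw : 2 * T * w = 2 * T * dot y v + enorm y ^+ 2 by rewrite /w; field; rewrite gt_eqF.
rewrite -addrA -/w -ler_sqr ?nnegrE ?enorm_ge0//; last by lra.
rewrite sqr_enorm dotDl !dotDr !dotZl !dotZr (dot_unit v1) (dotC v y) -sqr_enorm.
by have := sqr_ge0 w; nra.
Qed.

                                                                            
                                                                              
(** The 1-Lipschitz bound from the two points x - T v and x + T v squeezes [h (x + y)], since far
    along v the distance is nearly an affine function of y. *)
Lemma steep_frechet h x v (T0 b : R) : Lip1 h -> enorm v = 1 -> 0 < b <= 1 ->
  (forall s : R, 0 <= s -> s <= T0 -> [/\ cube (x + s *: v), cube (x - s *: v),
     (1 - b ^+ 2) * s <= h (x + s *: v) - h x & (1 - b ^+ 2) * s <= h x - h (x - s *: v)]) ->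
  forall y, cube (x + y) -> enorm y <= b * T0 ->
    `|h (x + y) - h x - dot y v| <= 2 * b * enorm y.
Proof.
move=> Lh v1 /andP[b0 b1] H y cy yT.
have [/[dup] /enorm_eq0 -> ->|nz] := eqVneq (enorm y) 0.
  rewrite addr0 subrr sub0r mulr0 -(scale0r v) dotZl mul0r oppr0 normr0//.
have y0 : 0 < enorm y by rewrite lt_neqAle eq_sym nz enorm_ge0.
(* This balances the slope defect b ^ 2 * T = b * |y| against the curvature term |y| ^ 2 / (2 * T) =
   b * |y| / 2. *)
pose T := enorm y / b.
have T0' : 0 < T by rewrite divr_gt0.
have TT : T <= T0 by rewrite ler_pdivrMr// mulrC.
have yT' : enorm y = b * T by rewrite /T; field; rewrite gt_eqF.
have [c1 c2 s1 s2] := H T (ltW T0') TT.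
have yle : enorm y <= T by rewrite yT'; nra.
have q : enorm y ^+ 2 / (2 * T) = b * enorm y / 2.
  by rewrite {1}yT' expr2 yT'; field; rewrite gt_eqF.
have up := enorm_add_le v1 T0' yle.
have dn := @enorm_add_le v (- y) T v1 T0' _; rewrite enormN in dn; have {}dn := dn yle.
rewrite dotNl q in dn; rewrite q in up.
have l1 := Lh _ _ cy c2; have l2 := Lh _ _ cy c1.
have e1 : x + y - (x - T *: v) = y + T *: v by apply/rowP => i; rewrite !mxE; ring.
have e2 : x + y - (x + T *: v) = - (- y + T *: v).
  by apply/rowP => i; rewrite !mxE; ring.
rewrite e1 in l1; rewrite e2 enormN in l2.
have bT : b ^+ 2 * T = b * enorm y by rewrite yT' expr2 mulrA.
move: l1 l2; rewrite !ler_norml => l1 l2.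
have : 0 <= b * enorm y by rewrite mulr_ge0// ltW.
lra.
Qed.

Lemma frechet_differentiable h x v :
  (forall e : R, 0 < e -> exists2 r : R, 0 < r & forall y, enorm y < r ->
     `|h (x + y) - h x - dot y v| <= e * enorm y) -> differentiable h x.
Proof.
move=> H.
have lin : linear (fun y => dot y v : R).
  by move=> a y z; rewrite dotDl dotZl.
pose L : {linear V -> R} := HB.pack (fun y => dot y v : R)
  (GRing.isLinear.Build R V R *:%R (fun y => dot y v) lin).
have Lc : continuous L.
  move=> y; have FF : Filter (nbhs y) := nbhs_filter y.
  apply/(@cvgrPdist_le _ _ _ (nbhs y) FF L (L y)) => e e0.
  pose C : R := d%:R * enorm v + 1.
  have C0 : 0 < C by rewrite /C ltr_wpDl// mulr_ge0// enorm_ge0.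
  apply/nbhs_ballP; exists (e / C) => /=; first exact: divr_gt0.
  move=> z; rewrite -ball_normE/= ltr_pdivlMr// => yz.
  rewrite -[L y - L z]dotBl; apply: (le_trans (normr_dot_le _ _)).
  apply: (@le_trans _ _ (C * `|y - z|)); last by rewrite mulrC ltW.
  have := enorm_le_norm (y - z); have := enorm_ge0 v; have := normr_ge0 (y - z).
  by rewrite /C; nra.
have HE : h \o shift x = cst (h x) + L +o_ (0 : V) id.
  apply/eqaddoP => e e0.
  pose e' := e / (d%:R + 1).
  have d0 : 0 <= d%:R :> R by [].
  have e'0 : 0 < e' by rewrite divr_gt0//; lra.
  have eE : e = (d%:R + 1) * e' by rewrite /e'; field; rewrite gt_eqF//; lra.
  have [r r0 rP] := H e' e'0.
  have dr : 0 < r / (d%:R + 1) by rewrite divr_gt0//; lra.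
  apply/nbhs_ballP; exists (r / (d%:R + 1)) => //= y.
  rewrite -ball_normE/= sub0r normrN => yr.
  have yn := enorm_le_norm y; have y0 := normr_ge0 y.
  have : `|y| * (d%:R + 1) < r by rewrite -ltr_pdivlMr//; lra.
  move=> yr'; have /rP : enorm y < r by nra.
  rewrite !fctE /= (addrC y x) opprD addrA => hy; apply: (le_trans hy).
  by rewrite eE; nra.
have dE := diff_unique Lc HE.
by apply/diff_locallyP; rewrite dE.
Qed.

End Stage.

                                                     

(** * One stage: a point where a nearby function of the open dense set is steep *)

Section Step.
Context {R : realType} {d : nat} (g : (nat -> nat) -> 'rV[R]_d).
Notation V := 'rV[R]_d.
Notation mu := (@lebesgue_measure R).
Implicit Types (f h : V -> R) (x y z v : V).
Hypothesis d1 : (1 <= d)%N.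

(** A function with the tolerance for its later changes, a piece of Baire space with its admissible
    directions, a chosen direction, and the centre and radius of the ball on which the function is
    affine. *)
Record stage := Stage { sf : V -> R; srho : R; sY : set (nat -> nat); sW : set V;
  sv : V; sx : V; sth : R }.

                                                                               
                                                                               
                                                                                 
(** Coordinatewise closeness [kap b] gives Euclidean closeness D = b ^ 2 / 42. The loss of slope is
    40 D from the maximal inequality and 2 D from replacing the curve by a line, b ^ 2 in all. *)
Definition kap (b : R) := b ^+ 2 / (42 * d%:R).

Definition wf (b : R) (st : stage) :=
  [/\ [/\ Lip1 (sf st), 0 < srho st & 0 < sth st],
      [/\ sW st `<=` usphere, sW st (sv st) &
         forall (w : V) i, sW st w -> `|w ord0 i - sv st ord0 i| <= kap b],
      hered g (sW st) (sY st) /\ sY st !=set0,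
      forall z, enorm (z - sx st) <= sth st ->
        cube z /\ sf st z = sf st (sx st) + dot (z - sx st) (sv st) &
      forall t, sY st t -> enorm (g t - sx st) < sth st / 2].

Lemma enorm_continuous (p : R -> V) (L : R) : 0 <= L ->
  (forall s t, enorm (p s - p t) <= L * `|s - t|) -> continuous p.
Proof.
move=> L0 pL t; apply/cvgrPdist_le => e e0.
have L1 : 0 < L + 1 by lra.
apply/nbhs_ballP; exists (e / (L + 1)) => /=; first exact: divr_gt0.
move=> s; rewrite /ball/= ltr_pdivlMr// => ts.
apply: (le_trans (norm_le_enorm _)); apply: (le_trans (pL t s)).
by have := normr_ge0 (t - s); nra.
Qed.

Lemma closure_enorm_le (S : set V) x0 (r : R) x : (forall y, S y -> enorm (y - x0) < r) ->
  closure S x -> enorm (x - x0) <= r.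
Proof.
move=> Sr clx; apply/ler_addgt0Pr => e e0.
have [y /Sr yr yx] := enorm_closure e0 clx.
by have := ler_enorm_trans y x x0; rewrite (enormC x y); lra.
Qed.

Lemma dR1 : 1 <= d%:R :> R.
Proof. by rewrite (_ : 1 = 1%:R)// ler_nat. Qed.

Lemma kapE b : d%:R * kap b = b ^+ 2 / 42.
Proof. by rewrite /kap; field; have := dR1; lra. Qed.

Lemma slope_transfer h x y w (u la D : R) : Lip1 h -> cube y -> cube (x + (u * la) *: w) ->
  enorm (y - x - (u * la) *: w) <= 2 * D * la * u ->
  (la - 40 * D * la) * u <= h y - h x ->
  (1 - 42 * D) * (u * la) <= h (x + (u * la) *: w) - h x.
Proof.
move=> Lh cy cw; have := Lh _ _ cy cw.
rewrite opprD addrA ler_norml; lra.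
Qed.

(** Along the extracted curve [gam] the affine function rises at rate almost [la], hence so does a
    sufficiently close [h] over the whole density interval. The deficit [q] is nondecreasing with
    small total growth, so [slow_point] gives a time in the closure where [h] is steep at all scales
    within the interval; larger scales are inherited from the affine function. *)
Lemma stage_point b st (U : set (V -> R)) : 0 < b <= 1 / 2 -> wf b st ->
  rel_open_Lip1 U -> dense_Lip1 U ->
  exists h, exists r : R, exists x, [/\ Lip1 h /\ 0 < r,
    forall F, Lip1 F -> unif_close r h F -> U F,
    forall z, cube z -> `|sf st z - h z| <= srho st / 4,
    closure (g @` sY st) x &
    forall s : R, 0 <= s -> s <= sth st / 2 ->
      [/\ cube (x + s *: sv st), cube (x - s *: sv st),
     (1 - b ^+ 2) * s <= h (x + s *: sv st) - h x &
     (1 - b ^+ 2) * s <= h x - h (x - s *: sv st)]].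
Proof.
case: st => f rho Y W v x0 th /= b01 [/= [Lf rho0 th0] [Ws Wv Wk] [hY [y0 Yy0]] aff Yx] oU dU.
have b0 : 0 < b by lra.
have dp : 0 < d%:R :> R by have := dR1; lra.
have v1 : enorm v = 1 by exact: Ws.
pose D := b ^+ 2 / 42.
have D0 : 0 < D by rewrite divr_gt0// exprn_gt0.
have k0 : 0 < kap b by rewrite divr_gt0 ?exprn_gt0// mulr_gt0.
have nW : ~ wnull W (closure (g @` Y)).
  apply: closure_not_wnull => c; apply: (hY y0 Yy0 0%N); apply: coverableS c => //.
  by apply: image_subset => t [].
have [la [gam [la0 gl] nE]] :=
  curve_extract k0 (fun i => usphere_coord i (Ws _ Wv)) Wk nW.
have gv s t : enorm (gam s - gam t - ((s - t) * la) *: v) <= 2 * D * la * `|s - t|.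
  have -> : 2 * D * la * `|s - t| = d%:R * (2 * kap b * la * `|s - t|).
    by rewrite /D -kapE; ring.
  by apply: enorm_le_coord => i; have := gl s t i; rewrite !mxE (mulrA (s - t)).
pose M := la * (1 + 2 * D).
have M0 : 0 < M by rewrite mulr_gt0//; lra.
have gM s t : enorm (gam s - gam t) <= M * `|s - t|.
  have := ler_enormD (gam s - gam t - ((s - t) * la) *: v) (((s - t) * la) *: v).
  rewrite subrK enormZ v1 mulr1 normrM (gtr0_norm la0); have := gv s t.
  by rewrite /M; nra.
pose E := `[0, 1]%classic `&` gam @^-1` (closure (g @` Y)).
have cE : closed E.
  apply: closedI; first exact: interval_closed.
  apply: closed_comp; last exact: closed_closure.
  by move=> t _; exact: (enorm_continuous (ltW M0) gM).
have nE' : ~ mu.-negligible E.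
  by apply: contra_not nE; apply: negligibleS => t [t01 clt]; split=> //=; rewrite in_itv.
have l0 : 0 < th / (2 * M) by rewrite divr_gt0// mulr_gt0.
have [c [r [Ec r0 rl] dE]] := density_ball (closed_measurable cE) nE' l0.
have rM : M * r <= th / 2 by move: rl; rewrite ltr_pdivlMr; [lra|rewrite mulr_gt0].
have clx0 z : closure (g @` Y) z -> enorm (z - x0) <= th / 2.
  by apply: closure_enorm_le => _ [y Yy <-]; exact: Yx.
have gin s : c - r <= s <= c + r -> enorm (gam s - x0) <= th.
  move=> sr; have := ler_enorm_trans (gam c) (gam s) x0; have := clx0 _ Ec.2.
  have := gM s c; have : `|s - c| <= r by rewrite ler_norml; lra.
  by nra.
(* The interval length is fixed before [h], so [h] can be taken close relative to [r]. *)
pose del := Num.min (D * la * r / 2) (rho / 4).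
have del0 : 0 < del by rewrite lt_min !divr_gt0// !mulr_gt0.
have del1 : del <= D * la * r / 2 by rewrite ge_min lexx.
have del2 : del <= rho / 4 by rewrite ge_min lexx orbT.
have [h [Lh Uh fh]] := dU f Lf del del0.
have [rU rU0 hU] := oU h Lh Uh.
pose q t := M * t - h (gam t).
have Lhg s t : c - r <= s <= c + r -> c - r <= t <= c + r ->
    `|h (gam s) - h (gam t)| <= M * `|s - t|.
  move=> sr tr; have [cs _] := aff _ (gin s sr); have [ct _] := aff _ (gin t tr).
  by apply: le_trans (gM s t); exact: Lh.
have hq : {in `[c - r, c + r] &, {homo q : s t / s <= t}}.
  move=> s t; rewrite !in_itv/= => sr tr st; have := Lhg t s tr sr.
  by rewrite (ger0_norm (_ : 0 <= t - s)) ?subr_ge0// ler_norml /q; lra.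
have fh' z : cube z -> - del <= f z - h z <= del.
  by move=> cz; have := fh z cz; rewrite ltr_norml; lra.
have cr1 : c - r <= c + r <= c + r by lra.
have cr2 : c - r <= c - r <= c + r by lra.
(* In units of D * la * r: 4 from [M] exceeding [la], 4 from the deviation of the curve from a line,
   and 1 from 2 * del. *)
have qtot : q (c + r) - q (c - r) <= (9 * D * la) * r.
  have [c1 f1] := aff _ (gin _ cr1); have [c2 f2] := aff _ (gin _ cr2).
  have := fh' _ c1; have := fh' _ c2; rewrite f1 f2.
  have e1 : gam (c + r) - x0 = (gam (c - r) - x0) + ((2 * r * la) *: v +
     (gam (c + r) - gam (c - r) - (2 * r * la) *: v)).
    by apply/rowP => i; rewrite !mxE; ring.
  have := gv (c + r) (c - r).
  have -> : c + r - (c - r) = 2 * r by ring.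
  rewrite (gtr0_norm (_ : 0 < 2 * r)) ?mulr_gt0//.
  have := normr_dot_le (gam (c + r) - gam (c - r) - (2 * r * la) *: v) v.
  rewrite v1 mulr1 ler_norml e1 !dotDl dotZl (dot_unit v1) mulr1.
  set A := dot (gam (c + r) - gam (c - r) - (2 * r * la) *: v) v.
  set B := enorm _; set C := dot (gam (c - r) - x0) v.
  by rewrite /q /M; clear -del1; lra.
have b9 : 0 < 9 * D * la by rewrite !mulr_gt0.
have z4 : 4 * (9 * D * la) < 40 * D * la.
  by have := mulr_gt0 D0 la0; clear; lra.
have [t [Et tc] slow] := slow_point cE r0 b9 z4 hq qtot dE.
pose x := gam t.
have xx0 : enorm (x - x0) <= th / 2 by apply: clx0; exact: Et.2.
have incube w : enorm w = 1 -> forall s, 0 <= s -> s <= th / 2 ->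
    enorm (x + s *: w - x0) <= th.
  move=> w1 s s0 sth; rewrite addrAC; apply: (le_trans (ler_enormD _ _)).
  by rewrite enormZ w1 mulr1 (ger0_norm s0); clear -xx0 sth; lra.
have vN : enorm (- v) = 1 by rewrite enormN.
exists h, rU, x; split=> //.
  by move=> z cz; rewrite ler_norml; have := fh' z cz; clear -del2; lra.
  exact: Et.2.
have b42 : b ^+ 2 = 42 * D by rewrite /D; field.
have [cx fx] : cube x /\ f x = f x0 + dot (x - x0) v.
  by apply: aff; clear -xx0 th0; lra.
move=> s s0 sth; rewrite b42.
have [cp fp] := aff _ (incube v v1 s s0 sth).
have := aff _ (incube (- v) vN s s0 sth); rewrite scalerN => -[cm fm].
(* At scales beyond la * r / 2 the error 2 * del is at most 2 * D * s, and the affine function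
   itself supplies the slope. *)
have [sl|ls] := leP s (la * r / 2); last first.
  have p1 := fh' _ cp; have p2 := fh' _ cm; have p3 := fh' _ cx.
  rewrite fp (addrAC x) (dotDl (x - x0)) dotZl (dot_unit v1) mulr1 in p1.
  rewrite fm (addrAC x) (dotBl (x - x0)) dotZl (dot_unit v1) mulr1 in p2.
  rewrite fx in p3.
  have dD : 2 * del <= 2 * (D * s) by clear -del1 ls D0; nra.
  have Ds : 0 <= D * s by rewrite mulr_ge0// ltW.
  by split=> //; clear -p1 p2 p3 dD Ds; lra.
pose u := s / la.
have us : s = u * la by rewrite /u; field; rewrite gt_eqF.
have u0 : 0 <= u by rewrite divr_ge0// ltW.
have u1 : u <= r / 2 by rewrite ler_pdivrMr//; clear -sl; lra.
have ur1 : c - r <= t + u <= c + r by clear -tc u0 u1 r0; lra.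
have ur2 : c - r <= t - u <= c + r by clear -tc u0 u1 r0; lra.
have [c1 _] := aff _ (gin _ ur1); have [c2 _] := aff _ (gin _ ur2).
have e1 : t + u - t = u by ring.
have e2 : t - u - t = - u by ring.
have e3 : t - (t - u) = u by ring.
have Dlu : 0 <= D * la * u.
  by apply: mulr_ge0 u0; apply: mulr_ge0; exact: ltW.
split=> //; rewrite us in cp cm *.
- apply: (slope_transfer (y := gam (t + u))) => //.
    by have := gv (t + u) t; rewrite e1 (ger0_norm u0).
  have [/(_ ltac:(by rewrite lerDl)) + _] := slow _ ur1.
  by rewrite e1 /q -/x /M; clear -Dlu; lra.
- rewrite -scalerN in cm *.
  have H1 : enorm (gam (t - u) - x - (u * la) *: - v) <= 2 * D * la * u.
    by have := gv (t - u) t; rewrite e2 normrN (ger0_norm u0) mulNr scaleNr scalerN.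
  have H2 : (la - 40 * D * la) * u <= - h (gam (t - u)) - - h x.
    have [_ /(_ ltac:(by rewrite gerDl oppr_le0))] := slow _ ur2.
    by rewrite e3 /q -/x /M; clear -Dlu; lra.
  by have /= := slope_transfer (Lip1N Lh) c2 cm H1 H2; clear; lra.
Qed.

End Step.

(** * Passing from one stage to the next *)

Section Limit.
Context {R : realType} {d : nat} (g : (nat -> nat) -> 'rV[R]_d).
Notation V := 'rV[R]_d.
Implicit Types (f h F : V -> R) (x y z v : V).
Hypothesis d1 : (1 <= d)%N.
Hypothesis gc : baire_continuous g.

                                                                           
                                                                                
                                             
(** The last clause is what survives in the limit: whatever is done later within the tolerance, the
    slope along the old direction stays nearly 1 at scales between the new and the old radius, so
    consecutive steps cover all small scales. In 41 b, one b is the defect at the found point; 40 b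
    bounds the error 10 * b * sth st', as s is at least sth st' / 4. *)
Definition step_rel (b : R) (U : set (V -> R)) (m : nat) (st st' : stage (R := R) (d := d)) :=
  [/\ [/\ sY st' `<=` sY st, sW st' `<=` sW st &
         forall t t', sY st' t -> sY st' t' -> forall i, (i < m)%N -> t i = t' i],
     forall F, Lip1 F -> (forall z, cube z -> `|F z - sf st' z| <= srho st') -> U F,
     forall z, cube z -> `|sf st' z - sf st z| + srho st' <= srho st,
     [/\ sth st' <= sth st / 4, srho st' <= sth st' &
         forall t, sY st' t -> enorm (g t - sx st') < b * sth st'] &
     forall F x, Lip1 F -> (forall z, cube z -> `|F z - sf st' z| <= srho st') ->
       enorm (x - sx st') <= b * sth st' ->
       forall s : R, sth st' / 4 <= s -> s <= sth st / 4 ->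
       [/\ cube (x + s *: sv st), cube (x - s *: sv st),
           (1 - 41 * b) * s <= F (x + s *: sv st) - F x &
           (1 - 41 * b) * s <= F x - F (x - s *: sv st)]].

Lemma Lip1_max f h : Lip1 f -> Lip1 h -> Lip1 (fun z => Num.max (f z) (h z)).
Proof.
move=> Lf Lh y z cy cz; have := Lf y z cy cz; have := Lh y z cy cz.
by rewrite !ler_norml /Num.max; do 2 (case: ifPn; rewrite -?leNgt); lra.
Qed.

Lemma Lip1_min f h : Lip1 f -> Lip1 h -> Lip1 (fun z => Num.min (f z) (h z)).
Proof.
move=> Lf Lh y z cy cz; have := Lf y z cy cz; have := Lh y z cy cz.
by rewrite !ler_norml /Num.min; do 2 (case: ifPn; rewrite -?leNgt); lra.
Qed.

Lemma Lip1_shift f (c : R) : Lip1 f -> Lip1 (fun z => f z + c).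
Proof. by move=> Lf y z cy cz; rewrite opprD addrACA subrr addr0; exact: Lf. Qed.

Lemma Lip1_affine x v (c : R) : enorm v = 1 -> Lip1 (fun z => c + dot (z - x) v).
Proof.
move=> v1 y z cy cz.
have -> : c + dot (y - x) v - (c + dot (z - x) v) = dot (y - z) v by rewrite !dotBl; ring.
by have := normr_dot_le (y - z) v; rewrite v1 mulr1.
Qed.

Definition clip (sg a c : R) := Num.max (c - sg) (Num.min (c + sg) a).

Lemma clip_close (sg a c : R) : 0 <= sg -> - sg <= clip sg a c - c <= sg.
Proof.
by rewrite /clip /Num.max /Num.min; do 2 (case: ifPn; rewrite -?leNgt); lra.
Qed.

Lemma clip_id (sg a c : R) : - sg <= a - c <= sg -> clip sg a c = a.
Proof.
by rewrite /clip /Num.max /Num.min; do 2 (case: ifPn; rewrite -?leNgt); lra.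
Qed.

(** At the steep point [x] the function [h] is nearly affine with gradient [v], and new directions
    are within [b] of [v]. Clipping the affine function with the new gradient to a band around [h]
    leaves it unchanged on a small ball, remains 1-Lipschitz, and moves [h] by at most the width of
    the band. *)
Lemma stage_step (b b' : R) (st : stage) (U : set (V -> R)) (m : nat) :
  0 < b <= 1 / 2 -> 0 < b' -> wf g b st -> rel_open_Lip1 U -> dense_Lip1 U ->
  exists st', wf g b' st' /\ step_rel b U m st st'.
Proof.
move=> b01 b'0 wst oU dU.
have [h [rh [x [[Lh rh0] hU fh clx slope]]]] := stage_point d1 b01 wst oU dU.
case: st wst fh clx slope => f rho Y W v x0 th /=.
move=> [/= [Lf rho0 th0] [Ws Wv Wk] [hY [y0 Yy0]] aff Yx] fh clx slope.
have b0 : 0 < b by lra.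
have v1 : enorm v = 1 by exact: Ws.
have dp : 0 < d%:R :> R by have := dR1 d1 (R := R); lra.
have k'0 : 0 < kap (d := d) b' by rewrite divr_gt0 ?exprn_gt0// mulr_gt0.
have xx0 : enorm (x - x0) <= th / 2.
  by apply: closure_enorm_le clx => _ [y Yy <-]; exact: Yx.
(* The first bound keeps the ball within reach of [steep_frechet] at scale th / 2; the others make
   the band 3 * b * th' small against the radius of [U] around [h] and the old tolerance. *)
pose th' := Num.min (b * th / 2) (Num.min (rh / (12 * b)) (rho / (24 * b))).
have th'0 : 0 < th' by rewrite !lt_min !divr_gt0// mulr_gt0.
have t1 : th' <= b * th / 2 by rewrite ge_min lexx.
have t2 : 3 * b * th' <= rh / 4.
  have : th' <= rh / (12 * b) by rewrite !ge_min lexx orbT.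
  by rewrite ler_pdivlMr ?mulr_gt0//; lra.
have t3 : 3 * b * th' <= rho / 8.
  have : th' <= rho / (24 * b) by rewrite !ge_min lexx !orbT.
  by rewrite ler_pdivlMr ?mulr_gt0//; lra.
have t4 : th' <= th / 4 by nra.
have br0 : 0 < b * th' / 2 by rewrite divr_gt0// mulr_gt0.
have [Y' [W' [v' [[YY WW] W'v' Wk' hY' [Y'0 [Y'x Y'm]]]]]] :=
  localize m gc Ws hY clx br0 k'0.
have v'1 : enorm v' = 1 by apply: Ws; exact: WW.
have vv : enorm (v' - v) <= b.
  have : enorm (v' - v) <= d%:R * kap (d := d) b.
    by apply: enorm_le_coord => i; have := Wk _ i (WW _ W'v'); rewrite !mxE.
  by rewrite (kapE d1); nra.
(* On the ball of radius th' the deviation is at most 2 * b * th' from [steep_frechet] and b * th'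
   from the change of gradient. *)
pose sg := 3 * b * th'.
have sg0 : 0 < sg by rewrite !mulr_gt0.
pose a z := h x + dot (z - x) v'.
pose f' z := clip sg (a z) (h z).
have f'h z : - sg <= f' z - h z <= sg by apply: clip_close; exact: ltW.
have near z : enorm (z - x) <= th' -> cube z /\ f' z = a z.
  move=> zx; have cz : cube z.
    have [] // := aff z _; have := ler_enorm_trans x z x0; lra.
  split=> //.
  have := @steep_frechet _ _ h x v (th / 2) b Lh v1 ltac:(lra) slope (z - x).
  rewrite (addrC x) subrK => /(_ cz).
  have -> : enorm (z - x) <= b * (th / 2) by lra.
  move=> /(_ isT); have := normr_dot_le (z - x) (v' - v).
  have e1 : enorm (z - x) * enorm (v' - v) <= b * th'.
    by have := enorm_ge0 (z - x); have := enorm_ge0 (v' - v); nra.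
  have e2 : 2 * b * enorm (z - x) <= 2 * b * th'.
    by rewrite ler_pM2l// mulr_gt0.
  rewrite !ler_norml dotBr => h1 h2.
  have : - sg <= a z - h z <= sg by rewrite /a /sg; clear -h1 h2 e1 e2; lra.
  exact: clip_id.
have xnear : enorm (x - x) <= th' by rewrite subrr enorm0 ltW.
have fx : f' x = h x by rewrite (near x xnear).2 /a subrr -(scale0r v') dotZl mul0r addr0.
pose rho' := Num.min (b * th') (Num.min (rh / 4) (rho / 8)).
have rho'0 : 0 < rho' by rewrite !lt_min !divr_gt0// mulr_gt0.
have r1 : rho' <= b * th' by rewrite ge_min lexx.
have r2 : rho' <= rh / 4 by rewrite !ge_min lexx orbT.
have r3 : rho' <= rho / 8 by rewrite !ge_min lexx !orbT.
have Lf' : Lip1 f'.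
  apply: Lip1_max; first exact: Lip1_shift.
  by apply: Lip1_min; [exact: Lip1_shift|exact: Lip1_affine].
exists (Stage f' rho' Y' W' v' x th'); split.
  split=> //=.
  - by split=> //; apply: subset_trans Ws.
  - by move=> z /near[cz ->]; split=> //; rewrite fx.
  - by move=> t /Y'x; nra.
split=> //=.
- move=> F LF Ff; apply: hU => // z cz; have := Ff z cz; have := f'h z.
  by rewrite ltr_norml ler_norml -/sg in t2 *; clear -t2 r2 rh0; lra.
- move=> z cz; have := fh z cz; have := f'h z; rewrite -/sg in t3.
  rewrite ler_norml => h1 h2; suff : `|f' z - f z| <= rho / 2 by clear -r3 rho0; lra.
  by rewrite ler_norml; clear -h1 h2 t3 rho0; lra.
- by split=> //; [clear -r1 b01 th'0; nra|move=> t /Y'x; clear -br0; lra].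
move=> F z LF Ff zx s s1 s2.
have s0 : 0 <= s by clear -s1 th'0; lra.
have [cp cm sp sm] := slope s s0 ltac:(clear -s2 th0; lra).
have bt : b * th' <= th / 8 by clear -b0 b01 t4 th'0; nra.
have cub w : enorm w = 1 -> cube (z + s *: w).
  move=> w1; have [] // := aff (z + s *: w) _.
  have := ler_enorm_trans x (z + s *: w) x0.
  have -> : z + s *: w - x = (z - x) + s *: w by rewrite addrAC.
  have := ler_enormD (z - x) (s *: w); rewrite enormZ w1 mulr1 (ger0_norm s0).
  by clear -xx0 zx bt s2 th0; lra.
have cz : cube z by have [] // := near z _; clear -zx b01 th'0; nra.
have cx : cube x by have [] := near x xnear.
have zp := cub v v1; have := cub (- v); rewrite enormN scalerN => /(_ v1) zm.
have FH w : cube w -> - (4 * b * th') <= F w - h w <= 4 * b * th'.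
  by move=> cw; have := Ff w cw; have := f'h w; rewrite /sg ler_norml; clear -r1; lra.
have lx := Lh _ _ cz cx.
have lp := Lh _ _ zp cp; rewrite opprD addrACA subrr addr0 in lp.
have lm := Lh _ _ zm cm; rewrite opprD addrACA subrr addr0 in lm.
have bs : b * th' <= 4 * (b * s) by clear -b0 s1; nra.
have bb : b ^+ 2 * s <= b * s by rewrite ler_wpM2r//; clear -b0 b01; nra.
move: lx lp lm; rewrite !ler_norml => lx lp lm.
have := FH _ cz; have := FH _ zp; have := FH _ zm => F1 F2 F3.
have -> : (1 - 41 * b) * s = s - 41 * (b * s) by ring.
have E : (1 - b ^+ 2) * s = s - b ^+ 2 * s by ring.
rewrite E in sp sm.
by split=> //; clear -sp sm F1 F2 F3 lx lp lm zx bs bb; lra.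
Qed.

(** Pairwise intersecting compact intervals have a common point. *)
Lemma nested_limit (a r : nat -> R) : (forall j k, a j - r j <= a k + r k) ->
  exists l, forall k, `|l - a k| <= r k.
Proof.
move=> ar; pose S := range (fun j => a j - r j).
have S0 : S !=set0 by exists (a 0%N - r 0%N); exists 0%N.
exists (sup S) => k; rewrite ler_norml.
have : sup S <= a k + r k by apply: ge_sup => // _ [j _ <-].
have : a k - r k <= sup S.
  apply: ub_le_sup; last by exists k.
  by exists (a 0%N + r 0%N) => _ [j _ <-].
lra.
Qed.

End Limit.

(** * The limit function and its point of differentiability *)

Section Backward.
Context {R : realType} {d : nat} (g : (nat -> nat) -> 'rV[R]_d).
Notation V := 'rV[R]_d.
Hypothesis d1 : (1 <= d)%N.
Hypothesis gc : baire_continuous g.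
Hypothesis gcube : range g `<=` @open_cube R d.

Lemma open_cube_ball (x : V) : open_cube x -> exists2 r : R, 0 < r &
  forall z, enorm (z - x) <= r -> cube z.
Proof.
move=> ox.
have [r r0 rP] := open_cube_inner ox.
exists r => // z zr i; have := coord_le_enorm (z - x) i; have := rP i.
by rewrite !mxE ler_norml; lra.
Qed.

(** The stages are iterated with b tending to 0. Functions and directions converge by nesting, and
    the entries fixed at each step define a point of Baire space whose image lies near every
    centre. *)
Lemma differentiable_point (U : nat -> set (V -> R)) : ~ coverable usphere (range g) ->
  (forall n, rel_open_Lip1 (U n)) -> (forall n, dense_Lip1 (U n)) ->
  exists F s, [/\ Lip1 F, forall n, U n F & differentiable F (g s)].
Proof.
move=> nc oU dU.
pose b k : R := k.+2%:R^-1.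
have b0 k : 0 < b k by rewrite invr_gt0.
have b12 k : 0 < b k <= 1 / 2.
  rewrite b0/= ler_pdivlMr// mulrC -ler_pdivlMr ?invrK; last by [].
  by rewrite mul1r ler_nat.
have b_dec j k : (j <= k)%N -> b k <= b j by move=> jk; rewrite lef_pV2 ?posrE// ler_nat.
have b_small e : 0 < e -> exists k, b k <= e.
  move=> e0; exists (Num.truncn e^-1); rewrite /b -[leRHS]invrK lef_pV2 ?posrE ?invr_gt0//.
  by apply: le_trans (ltW (truncnS_gt _)) _; rewrite ler_nat.
have dp : 0 < d%:R :> R by have := dR1 d1 (R := R); lra.
have kap0 k : 0 < kap (d := d) (b k) by rewrite divr_gt0 ?exprn_gt0// mulr_gt0.
have [X0 [_ [s0 X0s0] hX0]] := hered_exists nc.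
have [r0 r00 r0P] := open_cube_ball (gcube (imageT g s0)).
have clx : closure (g @` X0) (g s0) by apply: subset_closure; exists s0.
have r02 : 0 < r0 / 2 by rewrite divr_gt0.
have [Y [W [v [[YX Wu] Wv Wk hY [Y0 [Yr _]]]]]] :=
  localize 0 gc (@subset_refl _ usphere) hX0 clx r02 (kap0 0%N).
pose st0 := Stage (fun z => 0 + dot (z - g s0) v) 1 Y W v (g s0) r0.
have wf0 : wf g (b 0%N) st0.
  split=> //=.
  - split=> //; apply: Lip1_affine; exact: Wu.
  - move=> z zr; split; first exact: r0P.
    by rewrite subrr -(scale0r v) dotZl mul0r !add0r.
have /choice[nxt nxtP] : forall q : nat * stage (R := R) (d := d), exists st',
    wf g (b q.1) q.2 -> wf g (b q.1.+1) st' /\ step_rel g (b q.1) (U q.1) q.1.+1 q.2 st'.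
  move=> [k st] /=; have [w|nw] := pselect (wf g (b k) st); last by exists st.
  have [st' H] := stage_step d1 gc k.+1 (b12 k) (b0 k.+1) w (oU k) (dU k).
  by exists st'.
pose sq := fix sq k := if k is k'.+1 then nxt (k', sq k') else st0.
have wfs k : wf g (b k) (sq k).
  by elim: k => [//|k IH] /=; have [] := nxtP (k, sq k) IH.
have rel k : step_rel g (b k) (U k) k.+1 (sq k) (sq k.+1).
  by have [] := nxtP (k, sq k) (wfs k).
have th0 k : 0 < sth (sq k) by have [[]] := wfs k.
have rho0 k : 0 < srho (sq k) by have [[]] := wfs k.
have thS k : sth (sq k.+1) <= sth (sq k) / 4 by have [_ _ _ []] := rel k.
have th_small e : 0 < e -> exists N, forall k, (N <= k)%N -> sth (sq k) <= e.
  move=> e0.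
  have key k : sth (sq k) * k.+1%:R <= r0.
    elim: k => [|k IH]; first by rewrite mulr1.
    apply: le_trans IH; rewrite -!natr1.
    have pq := thS k; have q0 := th0 k; have k0 := ler0n R k.
    have : 0 <= (k%:R + 1 + 1) * (sth (sq k) / 4 - sth (sq k.+1)).
      by apply: mulr_ge0; lra.
    by have := mulr_ge0 (ltW q0) k0; lra.
  exists (Num.truncn (r0 / e)) => k Nk.
  have : r0 / e < k.+1%:R by apply: lt_le_trans (truncnS_gt _) _; rewrite ler_nat.
  rewrite ltr_pdivrMr// => h; have := key k => h'.
  by rewrite -(ler_pM2r (_ : 0 < k.+1%:R))//; lra.
have Ymono j k : (j <= k)%N -> sY (sq k) `<=` sY (sq j).
  elim: k => [|k IH]; first by rewrite leqn0 => /eqP->.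
  rewrite leq_eqVlt => /predU1P[->//|]; rewrite ltnS => /IH.
  by apply: subset_trans; have [[]] := rel k.
have Wmono j k : (j <= k)%N -> sW (sq k) `<=` sW (sq j).
  elim: k => [|k IH]; first by rewrite leqn0 => /eqP->.
  rewrite leq_eqVlt => /predU1P[->//|]; rewrite ltnS => /IH.
  by apply: subset_trans; have [[]] := rel k.
have fmono j k z : (j <= k)%N -> cube z ->
    `|sf (sq k) z - sf (sq j) z| + srho (sq k) <= srho (sq j).
  move=> + cz; elim: k => [|k IH].
    by rewrite leqn0 => /eqP->; rewrite subrr normr0 add0r.
  rewrite leq_eqVlt => /predU1P[->|]; first by rewrite subrr normr0 add0r.
  rewrite ltnS => /IH h; have [_ _ /(_ z cz) h' _ _] := rel k.
  have := ler_normD (sf (sq k.+1) z - sf (sq k) z) (sf (sq k) z - sf (sq j) z).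
  by rewrite addrA subrK; lra.
have /choice[F FP] : forall z, exists l : R, cube z ->
    forall k, `|l - sf (sq k) z| <= srho (sq k).
  move=> z; have [cz|nz] := pselect (cube z); last by exists 0.
  have [l lP] : exists l : R, forall k, `|l - sf (sq k) z| <= srho (sq k); last by exists l.
  apply: nested_limit => j k; have := rho0 j; have := rho0 k; have [jk|/ltnW kj] := leqP j k.
    have := fmono j k z jk cz; have := ler_norm (sf (sq j) z - sf (sq k) z).
    by rewrite distrC; lra.
  have := fmono k j z kj cz; have := ler_norm (sf (sq j) z - sf (sq k) z); lra.
have LF : Lip1 F.
  move=> y z cy cz; apply/ler_addgt0Pr => e e0.
  have [N NP] := th_small (e / 2) ltac:(rewrite divr_gt0//).
  have [_ _ _ [_ rt _] _] := rel N; have tN := NP N.+1 (leqnSn N).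
  have [[Lf _ _] _ _ _ _] := wfs N.+1.
  have := FP y cy N.+1; have := FP z cz N.+1; have := Lf y z cy cz.
  by rewrite !ler_norml; lra.
have UF n : U n F.
  by have [_ H _ _ _] := rel n; apply: H => // z cz; exact: FP.
have /choice[y yP] : forall k, exists t, sY (sq k) t.
  by move=> k; have [_ _ [_ [t Yt]] _ _] := wfs k; exists t.
(* Stage i+1 fixes all entries of index below i+1, so entry i may be read off there. *)
pose s i := y i.+1 i.
have ys k t i : sY (sq k) t -> (i < k)%N -> t i = s i.
  move=> Yt ik; have [[_ _ H] _ _ _ _] := rel i.
  by apply: (H t (y i.+1)) => //; exact: Ymono ik _ Yt.
pose x := g s.
have ox : open_cube x by apply: gcube.
have [rc rc0 rcP] := open_cube_ball ox.
have xs k : enorm (x - sx (sq k.+1)) <= b k * sth (sq k.+1).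
  apply/ler_addgt0Pr => e e0; have [n nP] := gc s e0.
  have : enorm (g (y (maxn n k.+1)) - x) < e.
    by apply: nP => i ni; apply: ys (yP _) _; rewrite (leq_trans ni)// leq_maxl.
  have [_ _ _ [_ _ H] _] := rel k.
  have := H _ (Ymono _ _ (leq_maxr n k.+1) _ (yP _)).
  have := ler_enorm_trans (g (y (maxn n k.+1))) x (sx (sq k.+1)).
  by rewrite (enormC x (g (y (maxn n k.+1)))); lra.
have /choice[vs vsP] : forall i : 'I_d, exists l : R,
    forall k, `|l - sv (sq k) ord0 i| <= kap (d := d) (b k).
  move=> i; apply: nested_limit => j k.
  have vW k' : sW (sq k') (sv (sq k')) by have [_ []] := wfs k'.
  have := kap0 j; have := kap0 k; have [jk|/ltnW kj] := leqP j k.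
    have [_ [_ _ H] _ _ _] := wfs j.
    by have := H _ i (Wmono _ _ jk _ (vW k)); rewrite ler_norml; lra.
  have [_ [_ _ H] _ _ _] := wfs k.
  by have := H _ i (Wmono _ _ kj _ (vW j)); rewrite ler_norml; lra.
pose w : V := \row_i vs i.
have wv k : enorm (w - sv (sq k)) <= b k.
  have : enorm (w - sv (sq k)) <= d%:R * kap (d := d) (b k).
    by apply: enorm_le_coord => i; rewrite !mxE; exact: vsP.
  by rewrite (kapE d1); have := b12 k; nra.
have v1 k : enorm (sv (sq k)) = 1 by have [_ [Ws Wv' _] _ _ _] := wfs k; exact: Ws.
have w1 : enorm w = 1.
  have key e : 0 < e -> - e <= enorm w - 1 <= e.
    move=> /b_small[k ke]; have := ler_dist_enorm w (sv (sq k)); have := wv k.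
    by rewrite v1 ler_norml; lra.
  apply/eqP; rewrite eq_le; apply/andP; split; apply/ler_addgt0Pr => e /key; lra.
have cw (u : R) : 0 <= u -> u <= rc -> cube (x + u *: w) /\ cube (x - u *: w).
  move=> u0 ur; split; apply: rcP; rewrite addrAC subrr add0r ?enormN enormZ w1 mulr1;
  by rewrite (ger0_norm u0).
(* For a scale u, the first stage beyond K whose quarter radius is at most u identifies the step
   responsible for u. Replacing its direction by the limit direction costs one more b, whence 42. *)
have slope K (u : R) : 0 < u -> u <= sth (sq K) / 4 -> u <= rc ->
    (1 - 42 * b K) * u <= F (x + u *: w) - F x /\
    (1 - 42 * b K) * u <= F x - F (x - u *: w).
  move=> u0 uK uc.
  have [N NP] := th_small u u0.
  have ex : exists n, (K < n)%N && (sth (sq n) / 4 <= u).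
    exists (maxn N K.+1); rewrite leq_maxr/=.
    by have := NP _ (leq_maxl N K.+1); have := th0 (maxn N K.+1); lra.
  case: (ex_minnP ex) => -[//|n] /andP[Kn nu] nmin; rewrite ltnS in Kn.
  have un : u <= sth (sq n) / 4.
    move: Kn; rewrite leq_eqVlt => /predU1P[<-//|Kn].
    rewrite leNgt; apply/negP => /ltW un.
    by have := nmin n; rewrite Kn un ltnn => /(_ isT).
  have [_ _ _ _ H] := rel n.
  have [c1 c2 s1 s2] := H F x LF (fun z cz => FP z cz n.+1) (xs n) u nu un.
  have [c3 c4] := cw u (ltW u0) uc.
  have e1 : enorm (u *: (w - sv (sq n))) <= u * b n.
    by rewrite enormZ (gtr0_norm u0) ler_pM2l.
  have l1 := LF _ _ c3 c1; have l2 := LF _ _ c4 c2.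
  rewrite (_ : _ - (x + _) = u *: (w - sv (sq n))) in l1; last first.
    by apply/rowP => i; rewrite !mxE; ring.
  rewrite (_ : _ - (x - _) = - (u *: (w - sv (sq n)))) ?enormN in l2; last first.
    by apply/rowP => i; rewrite !mxE; ring.
  have bK := b_dec _ _ Kn.
  have ub : u * b n <= u * b K by rewrite ler_pM2l.
  by move: l1 l2; rewrite !ler_norml; clear -s1 s2 e1 ub; lra.
exists F, s; split=> //.
apply: (@frechet_differentiable _ _ F x w) => e e0.
pose be := Num.min 1 (e / 2).
have be0 : 0 < be by rewrite lt_min ltr01 divr_gt0.
have be1 : be <= 1 by rewrite ge_min lexx.
have bee : be <= e / 2 by rewrite ge_min lexx orbT.
(* Then 42 * b K <= be ^ 2, the slope defect that [steep_frechet] accepts. *)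
have [K Kb] := b_small (be ^+ 2 / 42) ltac:(by rewrite divr_gt0// exprn_gt0).
pose T0 := Num.min (sth (sq K) / 4) rc.
have T00 : 0 < T0 by rewrite lt_min rc0 divr_gt0.
have T1 : T0 <= sth (sq K) / 4 by rewrite ge_min lexx.
have T2 : T0 <= rc by rewrite ge_min lexx orbT.
exists (Num.min (be * T0) rc); first by rewrite lt_min rc0 mulr_gt0.
move=> z; rewrite lt_min => /andP[z1 z2].
have cz : cube (x + z) by apply: rcP; rewrite addrAC subrr add0r ltW.
have be01 : 0 < be <= 1 by rewrite be0.
apply: le_trans (_ : 2 * be * enorm z <= _); last first.
  by rewrite ler_wpM2r ?enorm_ge0//; lra.
apply: (steep_frechet LF w1 be01 (T0 := T0)) => //; last exact: ltW.
move=> u u0 uT; have [c1 c2] := cw u u0 (le_trans uT T2); split=> //.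
  have [->|un0] := eqVneq u 0; first by rewrite scale0r addr0 subrr mulr0.
  have up : 0 < u by rewrite lt_neqAle eq_sym un0.
  by have [h _] := slope K u up (le_trans uT T1) (le_trans uT T2); clear -h Kb up; nra.
have [->|un0] := eqVneq u 0; first by rewrite scale0r subr0 subrr mulr0.
have up : 0 < u by rewrite lt_neqAle eq_sym un0.
by have [_ h] := slope K u up (le_trans uT T1) (le_trans uT T2); clear -h Kb up; nra.
Qed.

End Backward.

Theorem theorem2p2 (R : realType) (d : nat) (A : set 'rV[R]_d) :
  (1 <= d)%N -> analytic A -> A `<=` @open_cube R d ->
  ((exists P : set 'rV[R]_d,
      [/\ Fsigma P, purely_unrectifiable P & A `<=` P]) <->
   residual_Lip1 (fun f : 'rV[R]_d -> R =>
      forall x, A x -> ~ differentiable f x)).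
Proof.
move=> d1 anA Ao; split.
  move=> [P [[F [cF PE]] puP AP]].
  apply: (@wnull_residual _ _ (Ordinal d1) A F Ao cF) => [n|]; last by rewrite -PE.
  apply: pu_wnull => // gam /puP; apply: negligibleS => t [t01 Ft]; split=> //=.
  by rewrite PE; exists n.
move=> [U [oU dU UA]].
(* A cover yields the purely unrectifiable set as its union; without one, analyticity produces a
   function in every [U n] that is differentiable at a point of [A]. *)
have [[F [cF nF AF]]|nc] := pselect (coverable usphere A).
  exists (\bigcup_n F n); split=> //; first by exists F.
  move=> gam gamc; rewrite preimage_bigcup setI_bigcupr.
  by apply: negligible_bigcup => n; exact: wnull_pu (nF n) gam gamc.
case: anA => [A0|[g [gc AE]]].
  case: nc; rewrite A0; exists (fun=> set0); split=> // n; [exact: closed0|exact: wnull_set0].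
rewrite AE in nc Ao UA.
have [f [s [Lf Uf df]]] := differentiable_point d1 gc Ao nc oU dU.
by case: (UA f Lf Uf (g s) (imageT g s)).
Qed.
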